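(* Over the system $\mathsf{ACA}_0^\omega$, either of the following statements implies $\mathsf{BOOT}$, i.e. the statement $(\forall Y^{2})(\exists X^{1})(\forall n^{0})\big[ n\in X \leftrightarrow (\exists f^{1})(Y(f, n)=0)\big]$: (a) a commutative ring over $\mathbb{N}^{\mathbb{N}}$ has a maximal ideal; (b) an integral domain over $\mathbb{N}^{\mathbb{N}}$ has a maximal ideal.
   Context: Finite types: $0$ is a type (natural numbers), and if $\sigma,\tau$ are types, so is $\sigma\to\tau$; $1\equiv 0\to 0$ and $n+1\equiv n\to 0$. Superscripts indicate types. Type $1$ objects are elements of $\mathbb{N}^{\mathbb{N}}$, type $2$ objects are functionals $\mathbb{N}^{\mathbb{N}}\to\mathbb{N}$. Pairs and finite sequences are coded as usual (finite sequences of type $1$ objects as type $1$ objects). $\mathsf{L}_\omega$ is the language with variables of every finite type, constants $0,1,<_0,+_0,\times_0,=_0$, the combinators $\Pi,\Sigma$ and the recursor $\mathbf{R}_0$. For $\tau=(\tau_1\to\dots\to\tau_k\to 0)$, $x=_\tau y$ means $(\forall z_1^{\tau_1}\dots z_k^{\tau_k})(xz_1\dots z_k=_0 yz_1\dots z_k)$. The system $\mathsf{RCA}_0^\omega$ has the axioms: (a) $0,1,<_0,+_0,\times_0$ form an ordered semi-ring with equality $=_0$; (b) the defining axioms of the combinators $\Pi,\Sigma$ (giving $\lambda$-abstraction); (c) $\mathbf{R}_0(f^1,m^0,0)=m$ and $\mathbf{R}_0(f,m,n+1)=f(n,\mathbf{R}_0(f,m,n))$; (d) extensionality: $(\forall x^\rho,y^\rho,\varphi^{\rho\to\tau})(x=_\rho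 y\to\varphi(x)=_\tau\varphi(y))$ for all types $\rho,\tau$; (e) induction for quantifier-free formulas of $\mathsf{L}_\omega$; (f) $\mathsf{QF}\text{-}\mathsf{AC}^{1,0}$, where $\mathsf{QF}\text{-}\mathsf{AC}^{\sigma,\tau}$ is $(\forall x^\sigma)(\exists y^\tau)A(x,y)\to(\exists Y^{\sigma\to\tau})(\forall x^\sigma)A(x,Y(x))$ for quantifier-free $A$ of $\mathsf{L}_\omega$. $\mathsf{ACA}_0^\omega$ is $\mathsf{RCA}_0^\omega+(\mu^2)$, where $(\mu^2)$ is $(\exists\mu^2)(\forall f^1)\big[(\exists n)(f(n)=0)\to[f(\mu(f))=0\wedge(\forall i<\mu(f))f(i)\neq0]\wedge[(\forall n)(f(n)\neq 0)\to\mu(f)=0]\big]$. Sets are given by characteristic functions: $X\subseteq\mathbb{N}$ is a type $1$ object, a subset of $\mathbb{N}^{\mathbb{N}}$ (in particular the domain of a ring, or an ideal) is given by a type $2$ functional, and a binary relation on it by a functional of type $(1\times1)\to0$. A commutative ring $R$ over $\mathbb{N}^{\mathbb{N}}$ consists of a set $|R|\subseteq\mathbb{N}^{\mathbb{N}}$ with distinguished elements $0_R,1_R$, an equivalence relation $=_R$, and operations $+_R,-_R,\times_R$ on $|R|$ satisfying the usual (commutative) ring axioms, including $0_R\neq_R1_R$. It is an integral domain if $(\forall s,r\in R)(r\times_Rs=_R0\to r=_R0\vee s=_R0)$. An ideal $I$ of $R$ is a set $I\subseteq|R|$ such that $0_R\in I$, $1_R\notin I$, closed under $+_R$, and satisfying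 $(\forall a\in I,r\in R)(r\times_Ra\in I)$. An ideal $M$ is maximal if $(\forall r\in R)(r\notin M\to(\exists s\in R)((r\times_Rs)-_R1\in M))$. *)

(* Defs.v *)
From Stdlib Require Import List.

Set Implicit Arguments.
Unset Strict Implicit.
Unset Printing Implicit Defensive.

Inductive ty : Set := ty0 | Arr (s t : ty).

Declare Scope ty_scope.
Delimit Scope ty_scope with ty.
Bind Scope ty_scope with ty.
Notation "s ~> t" := (Arr s t) (at level 55, right associativity) : ty_scope.
Local Open Scope ty_scope.

Definition ty1 : ty := ty0 ~> ty0.
Definition ty2 : ty := ty1 ~> ty0.

Definition ty_eq_dec (s t : ty) : {s = t} + {s <> t}.
Proof. decide equality. Defined.

(** De Bruijn syntax, with a separate index space for every type: [tVar s n] is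
    the variable bound by the [n]-th enclosing quantifier of type [s]
    (quantifiers of other types are not counted). *)
Inductive tm : ty -> Set :=
| tVar (s : ty) (n : nat) : tm s
| tApp (s t : ty) (f : tm (s ~> t)) (x : tm s) : tm t
| tZero : tm ty0
| tOne : tm ty0
| tAdd : tm (ty0 ~> ty0 ~> ty0)
| tMul : tm (ty0 ~> ty0 ~> ty0)
| tPi (r t : ty) : tm (r ~> t ~> r)
| tSigma (r s t : ty) : tm ((r ~> s ~> t) ~> (r ~> s) ~> r ~> t)
| tRec : tm ((ty0 ~> ty0 ~> ty0) ~> ty0 ~> ty0 ~> ty0).

(** Equality is primitive at type [ty0] only; the remaining connectives and the
    existential quantifier are the usual classical abbreviations. *)
Inductive fm : Set :=
| fEq (a b : tm ty0)
| fLt (a b : tm ty0)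
| fFal
| fImp (p q : fm)
| fAll (s : ty) (p : fm).

Definition fNeg (p : fm) : fm := fImp p fFal.
Definition fEx (s : ty) (p : fm) : fm := fNeg (fAll s (fNeg p)).

Fixpoint qf (p : fm) : Prop :=
  match p with
  | fEq _ _ | fLt _ _ | fFal => True
  | fImp p q => qf p /\ qf q
  | fAll _ _ => False
  end.

Definition subst : Set := forall s : ty, nat -> tm s.

Fixpoint tsub (e : subst) (s : ty) (a : tm s) : tm s :=
  match a in tm s return tm s with
  | tVar s n => e s n
  | tApp f x => tApp (tsub e f) (tsub e x)
  | tZero => tZero
  | tOne => tOne
  | tAdd => tAdd
  | tMul => tMul
  | tPi r t => tPi r t
  | tSigma r s t => tSigma r s t
  | tRec => tRec
  end.

Definition ids : subst := tVar.

Definition shift (r : ty) : subst :=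
  fun s n => if ty_eq_dec r s then tVar s (S n) else tVar s n.

(** At type [r], index [0] goes to [a] and index [n+1] to what [e] gives [n];
    at the other types this is [e]. *)
Definition scons (r : ty) (a : tm r) (e : subst) : subst :=
  fun s =>
    match ty_eq_dec r s with
    | left E =>
        match E in _ = s' return nat -> tm s' with
        | eq_refl => fun n => match n with O => a | S m => e r m end
        end
    | right _ => e s
    end.

Definition up (r : ty) (e : subst) : subst :=
  scons (tVar r 0) (fun s n => tsub (shift r) (e s n)).

Fixpoint fsub (e : subst) (p : fm) : fm :=
  match p with
  | fEq a b => fEq (tsub e a) (tsub e b)
  | fLt a b => fLt (tsub e a) (tsub e b)
  | fFal => fFal
  | fImp p q => fImp (fsub e p) (fsub e q)
  | fAll s p => fAll s (fsub (up s e) p)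
  end.

Definition lift (r : ty) (p : fm) : fm := fsub (shift r) p.
Definition inst (r : ty) (a : tm r) (p : fm) : fm := fsub (scons a ids) p.

(** Classical natural deduction.  Free variables of an axiom in [T] are implicitly
    universally quantified, as [prv_allI] does not lift [T]. *)
Section Provability.
Variable T : fm -> Prop.

Inductive prv : list fm -> fm -> Prop :=
| prv_ax G p : T p -> prv G p
| prv_hyp G p : In p G -> prv G p
| prv_impI G p q : prv (p :: G) q -> prv G (fImp p q)
| prv_impE G p q : prv G (fImp p q) -> prv G p -> prv G q
| prv_raa G p : prv (fNeg p :: G) fFal -> prv G p
| prv_allI G s p : prv (map (lift s) G) p -> prv G (fAll s p)
| prv_allE G s p (a : tm s) : prv G (fAll s p) -> prv G (inst a p).

End Provability.

Definition provable (T : fm -> Prop) (p : fm) : Prop := prv T nil p.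

(** Closed formulas are written below with bound names.  An [expr s] (a [form])
    is a term (a formula) given as a function of the number of enclosing
    quantifiers of each type.  A variable bound under [d s] quantifiers of type
    [s] and used under [d' s] of them has de Bruijn index [d' s - d s - 1]. *)

Definition depth : Set := ty -> nat.
Definition expr (s : ty) : Set := depth -> tm s.
Definition form : Set := depth -> fm.

Definition incr (s : ty) (d : depth) : depth :=
  fun t => if ty_eq_dec s t then S (d t) else d t.

Definition lall (s : ty) (p : expr s -> form) : form :=
  fun d => fAll s (p (fun d' => tVar s (d' s - d s - 1)) (incr s d)).

Definition closed (p : form) : fm := p (fun _ => 0).

Definition lcst (s : ty) (c : tm s) : expr s := fun _ => c.
Definition lapp (s t : ty) (f : expr (s ~> t)) (x : expr s) : expr t :=
  fun d => tApp (f d) (x d).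
Definition leq0 (a b : expr ty0) : form := fun d => fEq (a d) (b d).
Definition llt0 (a b : expr ty0) : form := fun d => fLt (a d) (b d).
Definition lfal : form := fun _ => fFal.
Definition limp (p q : form) : form := fun d => fImp (p d) (q d).

Definition lneg (p : form) : form := limp p lfal.
Definition land (p q : form) : form := lneg (limp p (lneg q)).
Definition lor (p q : form) : form := limp (lneg p) q.
Definition liff (p q : form) : form := land (limp p q) (limp q p).
Definition lex (s : ty) (p : expr s -> form) : form :=
  lneg (lall (fun x => lneg (p x))).

Definition is_set (s : ty) (X : expr (s ~> ty0)) : form :=
  lall (fun x : expr s =>
    lor (leq0 (lapp X x) (lcst tZero)) (leq0 (lapp X x) (lcst tOne))).
Definition mem (s : ty) (x : expr s) (X : expr (s ~> ty0)) : form :=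
  leq0 (lapp X x) (lcst tOne).

Definition all_in (D : expr ty2) (p : expr ty1 -> form) : form :=
  lall (fun x : expr ty1 => limp (mem x D) (p x)).
Definition ex_in (D : expr ty2) (p : expr ty1 -> form) : form :=
  lex (fun x : expr ty1 => land (mem x D) (p x)).

Declare Scope lw_scope.
Delimit Scope lw_scope with lw.
Bind Scope lw_scope with form.
Bind Scope lw_scope with expr.

Module LwNotations.

Notation "'ALL' x : s , p" := (lall (s := s%ty) (fun x => p%lw))
  (at level 200, x name, s at level 60, p at level 200) : lw_scope.
Notation "'EX' x : s , p" := (lex (s := s%ty) (fun x => p%lw))
  (at level 200, x name, s at level 60, p at level 200) : lw_scope.
Notation "'ALL' x \in D , p" := (all_in D (fun x => p%lw))
  (at level 200, x name, D at level 60, p at level 200) : lw_scope.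
Notation "'EX' x \in D , p" := (ex_in D (fun x => p%lw))
  (at level 200, x name, D at level 60, p at level 200) : lw_scope.
Notation "x \in X" := (mem x X) (at level 70, no associativity) : lw_scope.
Notation "f @@ x" := (lapp f x) (at level 39, left associativity) : lw_scope.
Notation "a == b" := (leq0 a b) (at level 70, no associativity) : lw_scope.
Notation "a < b" := (llt0 a b) : lw_scope.
Notation "p ==> q" := (limp p q) (at level 99, right associativity) : lw_scope.
Notation "p <==> q" := (liff p q) (at level 98, no associativity) : lw_scope.
Notation "p /\ q" := (land p q) : lw_scope.
Notation "p \/ q" := (lor p q) : lw_scope.
Notation "~ p" := (lneg p) : lw_scope.
Notation "0" := (lcst tZero) : lw_scope.
Notation "1" := (lcst tOne) : lw_scope.
Notation "a + b" := (lcst tAdd @@ a @@ b)%lw : lw_scope.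
Notation "a * b" := (lcst tMul @@ a @@ b)%lw : lw_scope.

End LwNotations.
Import LwNotations.
Local Open Scope lw_scope.

Fixpoint eqt (t : ty) : expr t -> expr t -> form :=
  match t return expr t -> expr t -> form with
  | ty0 => fun a b => a == b
  | s ~> t => fun f g => ALL z : s, eqt (f @@ z) (g @@ z)
  end.

(** Congruence of the term constructors with respect to equality at type 0 is an
    instance of [ext_axiom]; discreteness of the order and existence of
    differences follow by induction. *)
Inductive basic_axiom : form -> Prop :=
| ax_eq_refl : basic_axiom (ALL x : ty0, x == x)
| ax_eq_sym : basic_axiom (ALL x : ty0, ALL y : ty0, x == y ==> y == x)
| ax_eq_trans : basic_axiom
    (ALL x : ty0, ALL y : ty0, ALL z : ty0,
       x == y ==> y == z ==> x == z)
| ax_lt_cong : basic_axiom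
    (ALL x : ty0, ALL x' : ty0, ALL y : ty0, ALL y' : ty0,
       x == x' ==> y == y' ==> x < y ==> x' < y')
| ax_addA : basic_axiom
    (ALL x : ty0, ALL y : ty0, ALL z : ty0, (x + y) + z == x + (y + z))
| ax_addC : basic_axiom (ALL x : ty0, ALL y : ty0, x + y == y + x)
| ax_add0 : basic_axiom (ALL x : ty0, x + 0 == x)
| ax_mulA : basic_axiom
    (ALL x : ty0, ALL y : ty0, ALL z : ty0, (x * y) * z == x * (y * z))
| ax_mulC : basic_axiom (ALL x : ty0, ALL y : ty0, x * y == y * x)
| ax_mul1 : basic_axiom (ALL x : ty0, x * 1 == x)
| ax_mul0 : basic_axiom (ALL x : ty0, x * 0 == 0)
| ax_mulD : basic_axiom
    (ALL x : ty0, ALL y : ty0, ALL z : ty0,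
       x * (y + z) == (x * y) + (x * z))
| ax_lt_irr : basic_axiom (ALL x : ty0, ~ (x < x))
| ax_lt_trans : basic_axiom
    (ALL x : ty0, ALL y : ty0, ALL z : ty0,
       x < y ==> y < z ==> x < z)
| ax_lt_total : basic_axiom
    (ALL x : ty0, ALL y : ty0, (x < y) \/ (x == y) \/ (y < x))
| ax_lt01 : basic_axiom (0 < 1)
| ax_lt_add : basic_axiom
    (ALL x : ty0, ALL y : ty0, ALL z : ty0,
       x < y ==> x + z < y + z)
| ax_lt_mul : basic_axiom
    (ALL x : ty0, ALL y : ty0, ALL z : ty0,
       0 < z ==> x < y ==> x * z < y * z).

Definition pi_axiom (r t : ty) : form :=
  ALL x : r, ALL y : t, eqt (lcst (tPi r t) @@ x @@ y) x.

Definition sigma_axiom (r s t : ty) : form :=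
  ALL x : r ~> s ~> t, ALL y : r ~> s, ALL z : r,
    eqt (lcst (tSigma r s t) @@ x @@ y @@ z) (x @@ z @@ (y @@ z)).

Definition rec_axiom : form :=
  ALL f : ty0 ~> ty0 ~> ty0, ALL m : ty0,
    (lcst tRec @@ f @@ m @@ 0 == m) /\
    (ALL n : ty0,
       lcst tRec @@ f @@ m @@ (n + 1) == f @@ n @@ (lcst tRec @@ f @@ m @@ n)).

Definition ext_axiom (r t : ty) : form :=
  ALL x : r, ALL y : r, ALL phi : r ~> t,
    eqt x y ==> eqt (phi @@ x) (phi @@ y).

(** [A] has the induction variable at index [0] of type [ty0]; its other
    variables are parameters. *)
Definition induction_axiom (A : fm) : fm :=
  let succ : tm ty0 := tApp (tApp tAdd (tVar ty0 0)) tOne in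
  fImp (inst tZero A)
    (fImp (fAll ty0 (fImp A (fsub (scons succ (shift ty0)) A)))
       (fAll ty0 A)).

(** [A] has [x] at index [0] of type [1] and [y] at index [0] of type [0].  In
    the conclusion [Y] is a new variable of type [2], and [y] becomes [Y x]. *)
Definition qfac_axiom (A : fm) : fm :=
  let Yx : tm ty0 := tApp (tVar ty2 0) (tVar ty1 0) in
  fImp (fAll ty1 (fEx ty0 A))
    (fEx ty2 (fAll ty1 (fsub (scons Yx (shift ty2)) A))).

Inductive RCA0w : fm -> Prop :=
| RCA0w_basic p : basic_axiom p -> RCA0w (closed p)
| RCA0w_pi r t : RCA0w (closed (pi_axiom r t))
| RCA0w_sigma r s t : RCA0w (closed (sigma_axiom r s t))
| RCA0w_rec : RCA0w (closed rec_axiom)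
| RCA0w_ext r t : RCA0w (closed (ext_axiom r t))
| RCA0w_induction A : qf A -> RCA0w (induction_axiom A)
| RCA0w_qfac A : qf A -> RCA0w (qfac_axiom A).

Definition mu_axiom : form :=
  EX mu : ty2, ALL f : ty1,
    ((EX n : ty0, f @@ n == 0) ==>
       (f @@ (mu @@ f) == 0) /\
       (ALL i : ty0, i < mu @@ f ==> ~ (f @@ i == 0))) /\
    ((ALL n : ty0, ~ (f @@ n == 0)) ==> mu @@ f == 0).

Inductive ACA0w : fm -> Prop :=
| ACA0w_RCA0w p : RCA0w p -> ACA0w p
| ACA0w_mu : ACA0w (closed mu_axiom).

(** The pair [(f, n)] coded by the type 1 object [n, f 0, f 1, ...]; here
    [tSigma (tPi tPi) f] is [fun i r => f i]. *)
Definition pair10 (f : expr ty1) (n : expr ty0) : expr ty1 :=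
  lcst tRec
    @@ (lcst (tSigma ty0 ty0 (ty0 ~> ty0))
          @@ (lcst (tPi (ty0 ~> ty0 ~> ty0) ty0) @@ lcst (tPi ty0 ty0))
          @@ f)
    @@ n.

Definition BOOT : form :=
  ALL Y : ty2, EX X : ty1, is_set X /\
    (ALL n : ty0, (n \in X) <==> (EX f : ty1, Y @@ pair10 f n == 0)).

Section Rings.

(** Operations and relations on type 1 objects are curried, so that
    [(1 x 1) -> 0] is [ty1 ~> ty1 ~> ty0]. *)
Variables (D : expr ty2) (zero one : expr ty1)
  (eqR : expr (ty1 ~> ty1 ~> ty0)) (add mul : expr (ty1 ~> ty1 ~> ty1))
  (opp : expr (ty1 ~> ty1)).

Local Notation "x =R y" := (eqR @@ x @@ y == 1) (at level 70) : lw_scope.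
Local Notation "x +R y" := (add @@ x @@ y) (at level 50, left associativity)
  : lw_scope.
Local Notation "x *R y" := (mul @@ x @@ y) (at level 40, left associativity)
  : lw_scope.
Local Notation "-R x" := (opp @@ x) (at level 35, right associativity)
  : lw_scope.

Definition is_comm_ring : form :=
  is_set D /\
  (ALL x : ty1, is_set (eqR @@ x)) /\
  (zero \in D) /\ (one \in D) /\
  (ALL x \in D, ALL y \in D, x +R y \in D) /\
  (ALL x \in D, -R x \in D) /\
  (ALL x \in D, ALL y \in D, x *R y \in D) /\
  (ALL x \in D, x =R x) /\
  (ALL x \in D, ALL y \in D, x =R y ==> y =R x) /\
  (ALL x \in D, ALL y \in D, ALL z \in D,
     x =R y ==> y =R z ==> x =R z) /\
  (ALL x \in D, ALL x' \in D, ALL y \in D, ALL y' \in D,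
     x =R x' ==> y =R y' ==> x +R y =R x' +R y') /\
  (ALL x \in D, ALL x' \in D, x =R x' ==> -R x =R -R x') /\
  (ALL x \in D, ALL x' \in D, ALL y \in D, ALL y' \in D,
     x =R x' ==> y =R y' ==> x *R y =R x' *R y') /\
  (ALL x \in D, ALL y \in D, ALL z \in D,
     (x +R y) +R z =R x +R (y +R z)) /\
  (ALL x \in D, ALL y \in D, x +R y =R y +R x) /\
  (ALL x \in D, x +R zero =R x) /\
  (ALL x \in D, x +R -R x =R zero) /\
  (ALL x \in D, ALL y \in D, ALL z \in D,
     (x *R y) *R z =R x *R (y *R z)) /\
  (ALL x \in D, ALL y \in D, x *R y =R y *R x) /\
  (ALL x \in D, x *R one =R x) /\
  (ALL x \in D, ALL y \in D, ALL z \in D,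
     x *R (y +R z) =R (x *R y) +R (x *R z)) /\
  (~ (zero =R one)).

Definition is_integral_domain : form :=
  is_comm_ring /\
  (ALL s \in D, ALL r \in D,
     r *R s =R zero ==> (r =R zero) \/ (s =R zero)).

Definition is_ideal (I : expr ty2) : form :=
  is_set I /\
  (ALL x \in I, x \in D) /\
  (zero \in I) /\ (~ (one \in I)) /\
  (ALL a \in I, ALL b \in I, a +R b \in I) /\
  (ALL a \in I, ALL r \in D, r *R a \in I).

Definition is_maximal_ideal (M : expr ty2) : form :=
  is_ideal M /\
  (ALL r \in D, ~ (r \in M) ==>
     EX s \in D, (r *R s) +R -R one \in M).

End Rings.

Definition every_comm_ring_has_maximal_ideal : form :=
  ALL D : ty2, ALL zero : ty1, ALL one : ty1,
  ALL eqR : ty1 ~> ty1 ~> ty0,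
  ALL add : ty1 ~> ty1 ~> ty1, ALL mul : ty1 ~> ty1 ~> ty1,
  ALL opp : ty1 ~> ty1,
    is_comm_ring D zero one eqR add mul opp ==>
    EX M : ty2, is_maximal_ideal D zero one add mul opp M.

Definition every_integral_domain_has_maximal_ideal : form :=
  ALL D : ty2, ALL zero : ty1, ALL one : ty1,
  ALL eqR : ty1 ~> ty1 ~> ty0,
  ALL add : ty1 ~> ty1 ~> ty1, ALL mul : ty1 ~> ty1 ~> ty1,
  ALL opp : ty1 ~> ty1,
    is_integral_domain D zero one eqR add mul opp ==>
    EX M : ty2, is_maximal_ideal D zero one add mul opp M.

(* Main.v *)
(** By Henkin's completeness theorem it suffices to argue in an arbitrary model of
    ACA0w, which is made extensional by dividing the term model by [eqt].  An
    integral domain is a commutative ring, so (b) is the stronger claim.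

    Fix [Y], and let [X] be the set of all [n] with [Y (f, n) = 0] for some [f].
    Consider the integer valued functions on the finitely supported points of
    [N^N] that preserve congruences modulo every [m]; they include the coordinates
    [x_n].  By the Chinese remainder theorem, two such functions that are both
    nonzero somewhere on the points supported in a set [K] have a product that is
    nonzero at such a point: so they form a domain, and for each [K] the functions
    vanishing on the points supported in [K] form a prime ideal, which contains
    [x_n] iff [n] is not in [K].  Localize at the prime ideal of [X].  To make
    membership decidable, a fraction carries a sequence [w] of type 1 objects, and
    its denominator must be nonzero at some point supported in
    [{n : Y (w_n, n) = 0}].  The result is a local ring in which [x_n] is a unit iff
    [n] is in [X], so a maximal ideal computes [X]. *)

From Stdlib Require Import List Arith Lia Cantor Eqdep_dec Ring.
From Stdlib Require Import Classical ClassicalEpsilon FunctionalExtensionality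
  PropExtensionality ProofIrrelevance.
Require Import Defs.
Import ListNotations.

(** * Substitutions *)

(** The pattern of [scons] over an arbitrary family, so that substitutions and assignments in a
    model share one set of lemmas; [scons] itself is the instance at [tm]. *)
Definition vcons {D : ty -> Type} (r : ty) (a : D r) (e : forall s, nat -> D s)
  : forall s, nat -> D s :=
  fun s =>
    match ty_eq_dec r s with
    | left E =>
        match E in _ = s' return nat -> D s' with
        | eq_refl => fun n => match n with O => a | S m => e r m end
        end
    | right _ => e s
    end.

Lemma ty_eq_dec_refl s : ty_eq_dec s s = left eq_refl.
Proof.
  destruct (ty_eq_dec s s) as [E|n]; [|now elim n].
  now rewrite (UIP_dec ty_eq_dec E eq_refl).
Qed.

Lemma vcons_0 {D : ty -> Type} r (a : D r) e : vcons r a e r 0 = a.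
Proof. unfold vcons. now rewrite ty_eq_dec_refl. Qed.

Lemma vcons_S {D : ty -> Type} r (a : D r) e n : vcons r a e r (S n) = e r n.
Proof. unfold vcons. now rewrite ty_eq_dec_refl. Qed.

Lemma vcons_ne {D : ty -> Type} r (a : D r) e s : r <> s -> vcons r a e s = e s.
Proof. intros N. unfold vcons. now destruct (ty_eq_dec r s). Qed.

Ltac vc := change (@scons) with (@vcons tm).

Lemma shift_eq r n : shift r r n = tVar r (S n).
Proof. unfold shift. now rewrite ty_eq_dec_refl. Qed.

Lemma shift_ne r s n : r <> s -> shift r s n = tVar s n.
Proof. intros N. unfold shift. now destruct (ty_eq_dec r s). Qed.

Lemma env_eq {D : ty -> Type} r (e e' : forall s, nat -> D s) :
  e r 0 = e' r 0 -> (forall n, e r (S n) = e' r (S n)) ->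
  (forall s n, r <> s -> e s n = e' s n) -> e = e'.
Proof.
  intros H0 HS Hn. extensionality s. extensionality n.
  destruct (ty_eq_dec r s) as [<-|N]; [destruct n|]; auto.
Qed.

Lemma tsub_tsub e e' s (a : tm s) :
  tsub e (tsub e' a) = tsub (fun s n => tsub e (e' s n)) a.
Proof. induction a; simpl; congruence. Qed.

Lemma tsub_ids s (a : tm s) : tsub ids a = a.
Proof. induction a; simpl; unfold ids in *; congruence. Qed.

Lemma up_0 r e : up r e r 0 = tVar r 0.
Proof. apply vcons_0. Qed.

Lemma up_S r e n : up r e r (S n) = tsub (shift r) (e r n).
Proof. unfold up. vc. now rewrite vcons_S. Qed.

Lemma up_ne r e s n : r <> s -> up r e s n = tsub (shift r) (e s n).
Proof. intros N. unfold up. vc. now rewrite vcons_ne. Qed.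

Lemma up_ids r : up r ids = ids.
Proof.
  apply (env_eq r).
  - apply up_0.
  - intros n. rewrite up_S. apply shift_eq.
  - intros s n N. rewrite up_ne by easy. simpl. now apply shift_ne.
Qed.

Lemma scons_shift r (a : tm r) e s (b : tm s) :
  tsub (scons a e) (tsub (shift r) b) = tsub e b.
Proof.
  rewrite tsub_tsub. f_equal. apply (env_eq r).
  - rewrite shift_eq. simpl. vc. apply vcons_S.
  - intros n. rewrite shift_eq. simpl. vc. apply vcons_S.
  - intros s' n N. rewrite shift_ne by easy. simpl. vc.
    now rewrite vcons_ne.
Qed.

Lemma up_shift r e s (b : tm s) :
  tsub (up r e) (tsub (shift r) b) = tsub (shift r) (tsub e b).
Proof. unfold up. rewrite scons_shift. now rewrite tsub_tsub. Qed.

Lemma up_comp r e e' :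
  (fun s n => tsub (up r e) (up r e' s n)) = up r (fun s n => tsub e (e' s n)).
Proof.
  apply (env_eq r).
  - rewrite !up_0. simpl. apply up_0.
  - intros n. rewrite !up_S. apply up_shift.
  - intros s n N. rewrite !up_ne by easy. apply up_shift.
Qed.

Lemma fsub_fsub p : forall e e',
  fsub e (fsub e' p) = fsub (fun s n => tsub e (e' s n)) p.
Proof.
  induction p; intros e e'; simpl; rewrite ?tsub_tsub; try easy.
  - now rewrite IHp1, IHp2.
  - now rewrite IHp, up_comp.
Qed.

Lemma fsub_ids p : fsub ids p = p.
Proof. induction p; simpl; rewrite ?tsub_ids, ?up_ids; congruence. Qed.

Lemma inst_up r (a : tm r) e p : inst a (fsub (up r e) p) = fsub (scons a e) p.
Proof.
  unfold inst. rewrite fsub_fsub. f_equal. apply (env_eq r).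
  - rewrite up_0. simpl. vc; now rewrite !vcons_0.
  - intros n. rewrite up_S, scons_shift, tsub_ids.
    vc; now rewrite vcons_S.
  - intros s n N. rewrite up_ne by easy. rewrite scons_shift, tsub_ids.
    vc; now rewrite vcons_ne.
Qed.

Lemma fsub_inst r (a : tm r) e p :
  fsub e (inst a p) = inst (tsub e a) (fsub (up r e) p).
Proof.
  rewrite inst_up. unfold inst. rewrite fsub_fsub. f_equal.
  vc. apply (env_eq r).
  - now rewrite !vcons_0.
  - intros n. now rewrite !vcons_S.
  - intros s n N. now rewrite !vcons_ne by easy.
Qed.

Lemma fsub_lift r e p : fsub (up r e) (lift r p) = lift r (fsub e p).
Proof.
  unfold lift. rewrite !fsub_fsub. f_equal. extensionality s. extensionality n.
  exact (up_shift r e s (tVar s n)).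
Qed.

(** * Free variables *)

(* Finitely supported bounds on de Bruijn indices are multisets of types. *)
Definition dep (L : list ty) : depth := count_occ ty_eq_dec L.

Fixpoint tbd (d : depth) s (a : tm s) : Prop :=
  match a with
  | tVar s n => n < d s
  | tApp f x => tbd d _ f /\ tbd d _ x
  | _ => True
  end.

Fixpoint fbd (d : depth) (p : fm) : Prop :=
  match p with
  | fEq a b | fLt a b => tbd d _ a /\ tbd d _ b
  | fFal => True
  | fImp p q => fbd d p /\ fbd d q
  | fAll s p => fbd (incr s d) p
  end.

Lemma incr_eq s d : incr s d s = S (d s).
Proof. unfold incr. now rewrite ty_eq_dec_refl. Qed.

Lemma incr_ne s d t : s <> t -> incr s d t = d t.
Proof. intros N. unfold incr. now destruct (ty_eq_dec s t). Qed.

Lemma tbd_mono d d' s (a : tm s) :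
  (forall t, d t <= d' t) -> tbd d s a -> tbd d' s a.
Proof.
  intros Hd. induction a; simpl; try tauto. specialize (Hd s). lia.
Qed.

Lemma fbd_mono p : forall d d', (forall t, d t <= d' t) -> fbd d p -> fbd d' p.
Proof.
  induction p; simpl; intros d d' Hd; try tauto.
  - intros [H1 H2]; split; eapply tbd_mono; eassumption.
  - intros [H1 H2]; split; eapply tbd_mono; eassumption.
  - intros [H1 H2]; split; eauto.
  - apply IHp. intros t. unfold incr. destruct (ty_eq_dec s t); auto.
    now apply le_n_S.
Qed.

Lemma tsub_agree d e e' s (a : tm s) :
  tbd d s a -> (forall s n, n < d s -> e s n = e' s n) -> tsub e a = tsub e' a.
Proof.
  intros B H. induction a; simpl in *; auto. destruct B.
  now rewrite IHa1, IHa2.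
Qed.

Lemma fsub_agree p : forall d e e', fbd d p ->
  (forall s n, n < d s -> e s n = e' s n) -> fsub e p = fsub e' p.
Proof.
  induction p; simpl; intros d e e' B H.
  - f_equal; eapply tsub_agree; try apply H; apply B.
  - f_equal; eapply tsub_agree; try apply H; apply B.
  - easy.
  - destruct B. f_equal; eauto.
  - f_equal. eapply IHp; [exact B|]. intros t n.
    destruct (ty_eq_dec s t) as [<-|N].
    + rewrite incr_eq. destruct n; [now rewrite !up_0|]. intros Hn.
      rewrite !up_S. f_equal. apply H. lia.
    + rewrite incr_ne by easy. intros Hn. rewrite !up_ne by easy.
      f_equal. auto.
Qed.

(** A variable of index [n] contributes [n + 1] copies of its type, so multiplicities in the list
    are strict bounds on indices. Binders remove nothing in [fvs]; the bound may be too large, which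
    is harmless. *)
Fixpoint tvs s (a : tm s) : list ty :=
  match a with
  | tVar s n => repeat s (S n)
  | tApp f x => tvs _ f ++ tvs _ x
  | _ => []
  end.

Fixpoint fvs (p : fm) : list ty :=
  match p with
  | fEq a b | fLt a b => tvs _ a ++ tvs _ b
  | fFal => []
  | fImp p q => fvs p ++ fvs q
  | fAll s p => fvs p
  end.

Lemma dep_app L L' s : dep (L ++ L') s = dep L s + dep L' s.
Proof. apply count_occ_app. Qed.

Lemma tbd_tvs s (a : tm s) : tbd (dep (tvs s a)) s a.
Proof.
  induction a; simpl tvs; simpl tbd; auto.
  - unfold dep. rewrite ty_eq_dec_refl. rewrite count_occ_repeat_eq; auto.
  - split; eapply tbd_mono; try eassumption; intros u; rewrite dep_app; lia.
Qed.

Lemma fbd_fvs p : fbd (dep (fvs p)) p.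
Proof.
  induction p; simpl; auto.
  - split; eapply tbd_mono; try apply tbd_tvs; intros u; rewrite dep_app; lia.
  - split; eapply tbd_mono; try apply tbd_tvs; intros u; rewrite dep_app; lia.
  - split; eapply fbd_mono; try eassumption; intros u; rewrite dep_app; lia.
  - eapply fbd_mono; [|exact IHp]. intros u. unfold incr.
    destruct (ty_eq_dec s u); lia.
Qed.

(** * Derivations *)

Section Derivations.
Variable T : fm -> Prop.
Notation prv := (prv T).

Lemma prv_weak G p : prv G p -> forall G', incl G G' -> prv G' p.
Proof.
  induction 1; intros G' I.
  - now apply prv_ax.
  - apply prv_hyp; auto.
  - apply prv_impI, IHprv. intros x [<-|Hx]; [now left|right; auto].
  - eapply prv_impE; eauto.
  - apply prv_raa, IHprv. intros x [<-|Hx]; [now left|right; auto].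
  - apply prv_allI, IHprv. now apply incl_map.
  - apply prv_allE; auto.
Qed.

Lemma prv_nil G p : prv [] p -> prv G p.
Proof. intros H. apply (prv_weak _ _ H). apply incl_nil_l. Qed.

Lemma prv_exf G p : prv G fFal -> prv G p.
Proof.
  intros H. apply prv_raa. apply (prv_weak _ _ H). intros x; now right.
Qed.

Definition alls (L : list ty) (p : fm) : fm := fold_right fAll p L.

Definition stable (p : fm) : Prop := forall e, prv [] (fsub e p).

Lemma stable_all s p : stable (fAll s p) -> stable p.
Proof.
  intros H e.
  (* The substitution [e] is split into its value at index 0 of type [s] and the rest [e1];
     instantiating the quantifier with that value then restores [e]. *)
  set (e1 := fun t n => match ty_eq_dec s t with
                        | left _ => e t (S n) | right _ => e t n end).
  assert (E : scons (e s 0) e1 = e).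
  { apply (env_eq s); vc.
    - apply vcons_0.
    - intros n. rewrite vcons_S. unfold e1. now rewrite ty_eq_dec_refl.
    - intros t n N. rewrite vcons_ne by easy. unfold e1.
      now destruct (ty_eq_dec s t). }
  rewrite <- E, <- inst_up. apply prv_allE. apply (H e1).
Qed.

Lemma fbd_alls L p d : fbd (fun t => dep L t + d t) p -> fbd d (alls L p).
Proof.
  revert p d. induction L as [|s L IH]; simpl; intros p d B.
  - exact B.
  - apply IH. eapply fbd_mono; [|exact B]. intros t. unfold dep, incr. simpl.
    destruct (ty_eq_dec s t); lia.
Qed.

(* The universal closure of [p] is unchanged by any substitution, and
   instantiating it again yields every substitution instance of [p]. *)
Lemma prv_stable p : prv [] p -> stable p.
Proof.
  intros H.
  assert (HA : forall L, prv [] (alls L p)).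
  { induction L; simpl; auto. now apply prv_allI. }
  assert (S : stable (alls (fvs p) p)).
  { intros e. rewrite (fsub_agree _ (fun _ => 0) e ids), fsub_ids; auto.
    - apply fbd_alls. eapply fbd_mono; [|apply fbd_fvs]. intros; lia.
    - intros; lia. }
  revert S. generalize (fvs p). induction l; simpl; auto.
  intros S. apply IHl. now apply stable_all in S.
Qed.

(** The set of axioms is not assumed closed under substitution; instances of axioms are recovered by
    [prv_stable]. *)
Lemma prv_sub G p : prv G p -> forall e, prv (map (fsub e) G) (fsub e p).
Proof.
  induction 1; intros e; simpl in *.
  - apply prv_nil. revert e. now apply prv_stable, prv_ax.
  - now apply prv_hyp, in_map.
  - apply prv_impI. apply IHprv.
  - eapply prv_impE; [apply IHprv1|apply IHprv2].
  - apply prv_raa. apply IHprv.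
  - apply prv_allI. specialize (IHprv (up s e)). rewrite map_map in *.
    erewrite map_ext; [exact IHprv|]. intros q. symmetry. apply fsub_lift.
  - rewrite fsub_inst. apply prv_allE. apply IHprv.
Qed.

Lemma prv_fresh G s n q :
  (forall p, In p (fAll s q :: G) -> exists d, fbd d p /\ d s <= n) ->
  prv G (inst (tVar s n) q) -> prv G (fAll s q).
Proof.
  intros F H. apply prv_allI.
  (* Variable [n] of type [s] is moved to the place of the new quantifier, and all others are
     shifted past it. On formulas in which [n] is fresh this is the ordinary shift. *)
  set (e := fun t m => match ty_eq_dec s t with
      | left _ => if Nat.eq_dec m n then tVar t 0 else tVar t (S m)
      | right _ => tVar t m end).
  assert (L : forall d, d s <= n ->
              forall t m, m < d t -> e t m = shift s t m).
  { intros d Hd t m Hm. unfold e, shift. destruct (ty_eq_dec s t) as [<-|]; auto.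
    destruct (Nat.eq_dec m n); auto. lia. }
  assert (EG : map (fsub e) G = map (lift s) G).
  { apply map_ext_in. intros p Hp. destruct (F p) as (d & B & Hd).
    - now right.
    - unfold lift. eapply fsub_agree; eauto. }
  assert (Eq : fsub e (inst (tVar s n) q) = q).
  { unfold inst. rewrite fsub_fsub.
    destruct (F _ (or_introl eq_refl)) as (d & B & Hd). simpl in B.
    rewrite (fsub_agree _ _ _ ids B); [apply fsub_ids|].
    intros t m. vc. destruct (ty_eq_dec s t) as [<-|N].
    - rewrite incr_eq. intros Hm. destruct m.
      + rewrite vcons_0. simpl. unfold e. rewrite ty_eq_dec_refl.
        now destruct (Nat.eq_dec n n).
      + rewrite vcons_S. simpl. rewrite (L d) by (auto; lia). apply shift_eq.
    - rewrite incr_ne by easy. intros Hm. rewrite vcons_ne by easy. simpl.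
      rewrite (L d) by auto. now apply shift_ne. }
  rewrite <- EG, <- Eq. now apply prv_sub.
Qed.

End Derivations.

(** * Coding formulas *)

Notation pr a b := (Cantor.to_nat (a, b)).

Lemma pr_inj a b c d : pr a b = pr c d -> a = c /\ b = d.
Proof. intros H. apply Cantor.to_nat_inj in H. now inversion H. Qed.

Fixpoint cty (s : ty) : nat :=
  match s with ty0 => 0 | Arr s t => S (pr (cty s) (cty t)) end.

Fixpoint ctm s (a : tm s) : nat :=
  match a with
  | tVar s n => pr 0 (pr (cty s) n)
  | tApp f x => pr 1 (pr (ctm _ f) (ctm _ x))
  | tZero => pr 2 0
  | tOne => pr 3 0
  | tAdd => pr 4 0
  | tMul => pr 5 0
  | tPi r t => pr 6 (pr (cty r) (cty t))
  | tSigma r s t => pr 7 (pr (cty r) (pr (cty s) (cty t)))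
  | tRec => pr 8 0
  end.

Fixpoint cfm (p : fm) : nat :=
  match p with
  | fEq a b => pr 0 (pr (ctm _ a) (ctm _ b))
  | fLt a b => pr 1 (pr (ctm _ a) (ctm _ b))
  | fFal => pr 2 0
  | fImp p q => pr 3 (pr (cfm p) (cfm q))
  | fAll s p => pr 4 (pr (cty s) (cfm p))
  end.

Lemma cty_inj s : forall t, cty s = cty t -> s = t.
Proof.
  induction s; destruct t; cbn -[Cantor.to_nat]; intros H; try easy.
  injection H as H. apply pr_inj in H as [H1 H2]. f_equal; auto.
Qed.

Lemma ctm_inj s (a : tm s) :
  forall t (b : tm t), ctm s a = ctm t b -> existT tm s a = existT tm t b.
Proof.
  induction a; destruct b; cbn -[Cantor.to_nat]; intros H;
    apply pr_inj in H as [H0 H]; try discriminate H0; auto;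
    apply pr_inj in H as [H1 H2].
  - apply cty_inj in H1. now subst.
  - apply IHa1 in H1. apply IHa2 in H2.
    pose proof (projT1_eq H1) as E. simpl in E. injection E as -> ->.
    apply inj_pair2_eq_dec in H1; [|exact ty_eq_dec].
    apply inj_pair2_eq_dec in H2; [|exact ty_eq_dec]. now subst.
  - apply cty_inj in H1, H2. now subst.
  - apply pr_inj in H2 as [H2 H3]. apply cty_inj in H1, H2, H3. now subst.
Qed.

Lemma ctm_inj' s (a b : tm s) : ctm s a = ctm s b -> a = b.
Proof.
  intros H. apply ctm_inj in H. apply inj_pair2_eq_dec in H; auto.
  exact ty_eq_dec.
Qed.

Lemma cfm_inj p : forall q, cfm p = cfm q -> p = q.
Proof.
  induction p; destruct q; cbn -[Cantor.to_nat]; intros H;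
    apply pr_inj in H as [H0 H]; try discriminate H0; auto;
    apply pr_inj in H as [H1 H2].
  - f_equal; now apply ctm_inj'.
  - f_equal; now apply ctm_inj'.
  - f_equal; auto.
  - apply cty_inj in H1. subst. f_equal. auto.
Qed.

(** Decoding is by choice: injectivity of [cfm] alone makes every formula appear at the stage given
    by its code. *)
Definition enum (n : nat) : fm := epsilon (inhabits fFal) (fun p => cfm p = n).

Lemma enum_cfm p : enum (cfm p) = p.
Proof.
  apply cfm_inj. unfold enum. apply epsilon_spec. now exists p.
Qed.

(** * Henkin completion *)

Section Henkin.
Variables (T : fm -> Prop) (goal : fm).
Hypothesis unprovable : ~ prv T [] goal.
Notation prv := (prv T).

(** A refuted universal formula receives a counterexample instead of being added. As contexts are
    finite, a variable beyond all bounds is always available, and no constants need to be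
    adjoined. *)
Definition hstep (G : list fm) (p : fm) : list fm :=
  if excluded_middle_informative (prv (p :: G) fFal) then
    match p with
    | fAll s q =>
        fNeg (inst (tVar s (dep (flat_map fvs (p :: G)) s)) q) :: G
    | _ => G
    end
  else p :: G.

Fixpoint hseq (n : nat) : list fm :=
  match n with
  | 0 => [fNeg goal]
  | S n => hstep (hseq n) (enum n)
  end.

Definition hth (p : fm) : Prop := exists n, In p (hseq n).

Lemma fbd_flat G p : In p G -> fbd (dep (flat_map fvs G)) p.
Proof.
  intros H. eapply fbd_mono; [|apply fbd_fvs]. intros t.
  apply in_split in H as (G1 & G2 & ->).
  rewrite flat_map_app. simpl. rewrite !dep_app. lia.
Qed.

Lemma hseq_consistent n : ~ prv (hseq n) fFal.
Proof.
  induction n; simpl.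
  - intros H. apply unprovable. now apply prv_raa.
  - unfold hstep. destruct excluded_middle_informative as [P|P]; [|exact P].
    destruct (enum n) as [| | | |s q]; auto.
    (* If the counterexample were inconsistent, the context would prove the instance at a fresh
       variable, hence the universal formula, which it refutes. *)
    intros H. apply prv_raa in H. apply IHn.
    apply prv_impE with (fAll s q); [now apply prv_impI|].
    eapply prv_fresh; [|exact H]. intros p Hp.
    exists (dep (flat_map fvs (fAll s q :: hseq n))). split; auto.
    now apply fbd_flat.
Qed.

Lemma hseq_step n : incl (hseq n) (hseq (S n)).
Proof.
  simpl. unfold hstep. destruct excluded_middle_informative.
  - destruct (enum n); try apply incl_refl. apply incl_tl, incl_refl.
  - apply incl_tl, incl_refl.
Qed.

Lemma hseq_mono n m : n <= m -> incl (hseq n) (hseq m).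
Proof.
  induction 1; [apply incl_refl|]. eapply incl_tran; eauto. apply hseq_step.
Qed.

(** Each formula is decided at the stage of its own code; this replaces maximality of the theory. *)
Lemma hth_or p : hth p \/ prv (p :: hseq (cfm p)) fFal.
Proof.
  destruct (classic (prv (p :: hseq (cfm p)) fFal)) as [H|H]; auto.
  left. exists (S (cfm p)). simpl. rewrite enum_cfm. unfold hstep.
  destruct excluded_middle_informative; [easy|now left].
Qed.

Lemma hth_prv n p : prv (hseq n) p -> hth p.
Proof.
  intros H. destruct (hth_or p) as [|H']; auto.
  apply prv_impI in H'. destruct (hseq_consistent (n + cfm p)).
  apply prv_impE with p.
  - apply (prv_weak _ _ _ H'), hseq_mono. lia.
  - apply (prv_weak _ _ _ H), hseq_mono. lia.
Qed.

Lemma hth_in p : hth p -> exists n, prv (hseq n) p.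
Proof. intros [n H]. exists n. now apply prv_hyp. Qed.

Lemma hth_fal : ~ hth fFal.
Proof. intros H. apply hth_in in H as [n H]. now apply (hseq_consistent n). Qed.

Lemma hth_imp p q : hth (fImp p q) <-> (hth p -> hth q).
Proof.
  split.
  - intros H1 H2. apply hth_in in H1 as [n H1], H2 as [m H2].
    apply (hth_prv (n + m)). apply prv_impE with p.
    + apply (prv_weak _ _ _ H1), hseq_mono. lia.
    + apply (prv_weak _ _ _ H2), hseq_mono. lia.
  - intros H. destruct (hth_or p) as [Hp|Hp].
    + destruct (hth_in _ (H Hp)) as [n Hq]. apply (hth_prv n).
      apply prv_impI. apply (prv_weak _ _ _ Hq), incl_tl, incl_refl.
    + eapply hth_prv. apply prv_impI, prv_exf, Hp.
Qed.

Lemma hth_all s q : hth (fAll s q) <-> forall a : tm s, hth (inst a q).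
Proof.
  split.
  - intros H a. apply hth_in in H as [n H]. apply (hth_prv n).
    now apply prv_allE.
  - intros H. destruct (hth_or (fAll s q)) as [|H']; auto.
    exfalso. apply hth_fal.
    (* This is the variable that [hstep] picks when the universal formula is processed and
       rejected. *)
    set (a := tVar s (dep (flat_map fvs (fAll s q :: hseq (cfm (fAll s q)))) s)).
    assert (N : hth (fNeg (inst a q))).
    { exists (S (cfm (fAll s q))).
      change (In (fNeg (inst a q))
        (hstep (hseq (cfm (fAll s q))) (enum (cfm (fAll s q))))).
      rewrite enum_cfm. unfold hstep.
      destruct excluded_middle_informative; [now left|easy]. }
    apply (proj1 (hth_imp _ _) N), H.
Qed.

Lemma hth_goal : ~ hth goal.
Proof.
  intros H. apply hth_fal. apply (proj1 (hth_imp goal fFal)); auto.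
  exists 0. now left.
Qed.

Lemma hth_ax p e : T p -> hth (fsub e p).
Proof.
  intros H. apply (hth_prv 0). apply prv_nil.
  revert e. now apply prv_stable, prv_ax.
Qed.

End Henkin.

(** * Extensional models *)

Section Quotient.
Variables (A : Type) (R : A -> A -> Prop).
Hypotheses (R_refl : forall a, R a a) (R_sym : forall a b, R a b -> R b a)
  (R_trans : forall a b c, R a b -> R b c -> R a c).

Definition quot : Type := {P : A -> Prop | exists a, P = R a}.

Definition cls (a : A) : quot := exist _ (R a) (ex_intro _ a eq_refl).

Definition rpr (q : quot) : A :=
  proj1_sig (constructive_indefinite_description _ (proj2_sig q)).

Lemma cls_eq a b : cls a = cls b <-> R a b.
Proof.
  split.
  - intros H. apply (f_equal (@proj1_sig _ _)) in H. simpl in H.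
    rewrite H. apply R_refl.
  - intros H. apply subset_eq_compat. extensionality c.
    apply propositional_extensionality. split; eauto.
Qed.

Lemma cls_rpr q : cls (rpr q) = q.
Proof.
  destruct q as [P [a E]]. apply subset_eq_compat.
  unfold rpr. simpl. destruct constructive_indefinite_description as [b Eb].
  now simpl.
Qed.

Lemma rpr_cls a : R (rpr (cls a)) a.
Proof. apply cls_eq, cls_rpr. Qed.

End Quotient.

(** Equality at type 0 is read as true equality and functions are extensional. The combinator
    equations are built in; the remaining axioms enter through [models]. *)
Record emodel : Type := EModel {
  dom : ty -> Type;
  app : forall {s t}, dom (Arr s t) -> dom s -> dom t;
  app_ext : forall s t (f g : dom (Arr s t)),
    (forall x, app f x = app g x) -> f = g;
  mlt : dom ty0 -> dom ty0 -> Prop;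
  mzero : dom ty0;
  mone : dom ty0;
  madd : dom (Arr ty0 (Arr ty0 ty0));
  mmul : dom (Arr ty0 (Arr ty0 ty0));
  mK : forall r t, dom (Arr r (Arr t r));
  mK_eq : forall r t x y, app (app (mK r t) x) y = x;
  mS : forall r s t, dom (Arr (Arr r (Arr s t)) (Arr (Arr r s) (Arr r t)));
  mS_eq : forall r s t x y z,
    app (app (app (mS r s t) x) y) z = app (app x z) (app y z);
  mrec : dom (Arr (Arr ty0 (Arr ty0 ty0)) (Arr ty0 (Arr ty0 ty0)))
}.

Fixpoint ev (M : emodel) (v : forall s, nat -> dom M s) s (a : tm s) : dom M s :=
  match a with
  | tVar s n => v s n
  | tApp f x => app M (ev M v _ f) (ev M v _ x)
  | tZero => mzero M
  | tOne => mone M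
  | tAdd => madd M
  | tMul => mmul M
  | tPi r t => mK M r t
  | tSigma r s t => mS M r s t
  | tRec => mrec M
  end.

Fixpoint sat (M : emodel) (v : forall s, nat -> dom M s) (p : fm) : Prop :=
  match p with
  | fEq a b => ev M v _ a = ev M v _ b
  | fLt a b => mlt M (ev M v _ a) (ev M v _ b)
  | fFal => False
  | fImp p q => sat M v p -> sat M v q
  | fAll s p => forall x, sat M (vcons s x v) p
  end.

Definition models (M : emodel) (T : fm -> Prop) : Prop :=
  forall p v, T p -> sat M v p.

(** * The term model of a Henkin theory *)

Section TermModel.
Variable H : fm -> Prop.
Hypotheses (H_fal : ~ H fFal)
  (H_imp : forall p q, H (fImp p q) <-> (H p -> H q))
  (H_all : forall s q, H (fAll s q) <-> forall a : tm s, H (inst a q))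
  (H_ax : forall p e, ACA0w p -> H (fsub e p)).

Fixpoint teq (s : ty) : tm s -> tm s -> Prop :=
  match s with
  | ty0 => fun a b => H (fEq a b)
  | Arr s t => fun f g => forall x, teq t (tApp f x) (tApp g x)
  end.

(** An [expr] yields a different index at every depth. To give it a fixed meaning one follows all
    ways of entering and instantiating further quantifiers; [denotes] says that the resulting term
    never changes. *)
Inductive extends (d : depth) (e : subst) : depth -> subst -> Prop :=
| extends_refl : extends d e d e
| extends_step d' e' s (a : tm s) :
    extends d e d' e' -> extends d e (incr s d') (scons a e').

Lemma extends_push d e s (a : tm s) d' e' :
  extends (incr s d) (scons a e) d' e' -> extends d e d' e'.
Proof.
  induction 1.
  - apply extends_step, extends_refl.
  - now apply extends_step.
Qed.

Lemma extends_var d e d' e' : extends d e d' e' ->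
  forall s, d s <= d' s /\ forall i, e' s (d' s - d s + i) = e s i.
Proof.
  induction 1 as [|d' e' r a X IH]; intros s.
  - split; auto. intros i. f_equal. lia.
  - destruct (IH s) as [H1 H2]. vc. destruct (ty_eq_dec r s) as [<-|N].
    + rewrite incr_eq. split; [lia|]. intros i.
      replace (S (d' r) - d r + i) with (S (d' r - d r + i)) by lia.
      now rewrite vcons_S.
    + rewrite incr_ne, vcons_ne by easy. auto.
Qed.

Definition denotes d e s (a : expr s) (x : tm s) : Prop :=
  forall d' e', extends d e d' e' -> tsub e' (a d') = x.

Lemma denotes_push d e s (a : expr s) x r (y : tm r) :
  denotes d e s a x -> denotes (incr r d) (scons y e) s a x.
Proof. intros D d' e' X. apply D. eapply extends_push; eauto. Qed.

Lemma denotes_var d e s (x : tm s) :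
  denotes (incr s d) (scons x e) s (fun d' => tVar s (d' s - d s - 1)) x.
Proof.
  intros d' e' X. simpl. destruct (extends_var _ _ _ _ X s) as [H1 H2].
  specialize (H2 0). revert H1 H2. rewrite incr_eq. vc. rewrite vcons_0.
  intros H1 <-. f_equal. lia.
Qed.

Lemma denotes_app d e s t (f : expr (Arr s t)) (a : expr s) x y :
  denotes d e _ f x -> denotes d e _ a y -> denotes d e _ (lapp f a) (tApp x y).
Proof.
  intros D1 D2 d' e' X. simpl. f_equal; auto.
Qed.

Lemma H_lall s p d e : H (fsub e (@lall s p d)) <->
  forall a : tm s, H (fsub (scons a e)
                        (p (fun d' => tVar s (d' s - d s - 1)) (incr s d))).
Proof.
  unfold lall. simpl. rewrite H_all. split; intros X a; specialize (X a).
  - now rewrite inst_up in X.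
  - now rewrite inst_up.
Qed.

Lemma H_limp p q d e : H (fsub e (limp p q d)) <->
  (H (fsub e (p d)) -> H (fsub e (q d))).
Proof. apply H_imp. Qed.

Lemma H_eqt t : forall d e a b x y, denotes d e t a x -> denotes d e t b y ->
  (H (fsub e (eqt a b d)) <-> teq t x y).
Proof.
  induction t as [|s _ t IH]; intros d e a b x y D1 D2; simpl eqt; simpl teq.
  - rewrite <- (D1 _ _ (extends_refl _ _)), <- (D2 _ _ (extends_refl _ _)).
    reflexivity.
  - rewrite H_lall.
    assert (I : forall z, H (fsub (scons z e)
       (eqt (lapp a (fun d' => tVar s (d' s - d s - 1)))
            (lapp b (fun d' => tVar s (d' s - d s - 1))) (incr s d)))
       <-> teq t (tApp x z) (tApp y z)).
    { intros z. apply IH; apply denotes_app;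
        auto using denotes_push, denotes_var. }
    split; intros X z; specialize (X z); now apply I.
Qed.

Lemma H_basic p : basic_axiom p -> H (fsub ids (closed p)).
Proof. intros B. now apply H_ax, ACA0w_RCA0w, RCA0w_basic. Qed.

Lemma teq_ext s t (x y : tm s) (f : tm (Arr s t)) :
  teq s x y -> teq t (tApp f x) (tApp f y).
Proof.
  assert (A : H (fsub ids (closed (ext_axiom s t)))).
  { apply H_ax, ACA0w_RCA0w, RCA0w_ext. }
  unfold closed, ext_axiom in A.
  apply H_lall with (a := x) in A. apply H_lall with (a := y) in A.
  apply H_lall with (a := f) in A. rewrite H_limp in A.
  erewrite H_eqt, H_eqt in A; [exact A|..];
    repeat first [apply denotes_app|apply denotes_var|apply denotes_push].
Qed.

Lemma teq_K r t (x : tm r) (y : tm t) : teq r (tApp (tApp (tPi r t) x) y) x.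
Proof.
  assert (A : H (fsub ids (closed (pi_axiom r t)))).
  { apply H_ax, ACA0w_RCA0w, RCA0w_pi. }
  unfold closed, pi_axiom in A.
  apply H_lall with (a := x) in A. apply H_lall with (a := y) in A.
  erewrite H_eqt in A; [exact A|..];
    repeat first [apply denotes_app|apply denotes_var|apply denotes_push].
  now intros ? ? ?.
Qed.

Lemma teq_S r s t (x : tm (Arr r (Arr s t))) (y : tm (Arr r s)) (z : tm r) :
  teq t (tApp (tApp (tApp (tSigma r s t) x) y) z) (tApp (tApp x z) (tApp y z)).
Proof.
  assert (A : H (fsub ids (closed (sigma_axiom r s t)))).
  { apply H_ax, ACA0w_RCA0w, RCA0w_sigma. }
  unfold closed, sigma_axiom in A.
  apply H_lall with (a := x) in A. apply H_lall with (a := y) in A.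
  apply H_lall with (a := z) in A.
  erewrite H_eqt in A; [exact A|..];
    repeat first [apply denotes_app|apply denotes_var|apply denotes_push].
  now intros ? ? ?.
Qed.

Lemma teq_refl s (x : tm s) : teq s x x.
Proof.
  induction s as [|s _ t IH]; simpl; auto.
  pose proof (H_basic _ ax_eq_refl) as A. now apply H_lall with (a := x) in A.
Qed.

Lemma teq_sym s (x y : tm s) : teq s x y -> teq s y x.
Proof.
  induction s as [|s _ t IH]; simpl; auto.
  pose proof (H_basic _ ax_eq_sym) as A.
  apply H_lall with (a := x) in A. apply H_lall with (a := y) in A.
  now rewrite H_limp in A.
Qed.

Lemma teq_trans s (x y z : tm s) : teq s x y -> teq s y z -> teq s x z.
Proof.
  induction s as [|s _ t IH]; simpl; eauto.
  pose proof (H_basic _ ax_eq_trans) as A.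
  apply H_lall with (a := x) in A. apply H_lall with (a := y) in A.
  apply H_lall with (a := z) in A. rewrite !H_limp in A. exact A.
Qed.

Lemma H_lt x x' y y' : teq ty0 x x' -> teq ty0 y y' ->
  H (fLt x y) -> H (fLt x' y').
Proof.
  pose proof (H_basic _ ax_lt_cong) as A.
  apply H_lall with (a := x) in A. apply H_lall with (a := x') in A.
  apply H_lall with (a := y) in A. apply H_lall with (a := y') in A.
  rewrite !H_limp in A. exact A.
Qed.

Definition tcls s : tm s -> quot (tm s) (teq s) := cls (tm s) (teq s).

Lemma tcls_eq s (a b : tm s) : tcls s a = tcls s b <-> teq s a b.
Proof. apply cls_eq; [apply teq_refl|apply teq_sym|apply teq_trans]. Qed.

Lemma tcls_surj s q : exists a, tcls s a = q.
Proof.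
  exists (rpr _ _ q). apply cls_rpr.
Qed.

Definition qapp s t (f : quot _ (teq (Arr s t))) (x : quot _ (teq s)) :
  quot _ (teq t) := tcls t (tApp (rpr _ _ f) (rpr _ _ x)).

Lemma qapp_cls s t f x :
  qapp s t (tcls _ f) (tcls _ x) = tcls t (tApp f x).
Proof.
  (* First the argument is changed by the extensionality axiom, then the function, by the pointwise
     definition of [teq] at arrow types. *)
  apply tcls_eq. eapply teq_trans; [apply teq_ext, (rpr_cls _ (teq s))|].
  - apply teq_refl.
  - apply teq_sym.
  - apply teq_trans.
  - apply (rpr_cls _ (teq (Arr s t)) (teq_refl _) (teq_sym _) (teq_trans _)).
Qed.

Definition term_model : emodel.
Proof.
  refine {| dom s := quot (tm s) (teq s); app := qapp;
    mlt x y := H (fLt (rpr _ _ x) (rpr _ _ y));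
    mzero := tcls _ tZero; mone := tcls _ tOne;
    madd := tcls _ tAdd; mmul := tcls _ tMul;
    mK r t := tcls _ (tPi r t); mS r s t := tcls _ (tSigma r s t);
    mrec := tcls _ tRec |}.
  - intros s t f g. destruct (tcls_surj _ f) as [a <-], (tcls_surj _ g) as [b <-].
    intros E. apply tcls_eq. intros x. specialize (E (tcls _ x)).
    now rewrite !qapp_cls, tcls_eq in E.
  - intros r t x y. destruct (tcls_surj _ x) as [a <-], (tcls_surj _ y) as [b <-].
    rewrite !qapp_cls. apply tcls_eq, teq_K.
  - intros r s t x y z. destruct (tcls_surj _ x) as [a <-],
      (tcls_surj _ y) as [b <-], (tcls_surj _ z) as [c <-].
    rewrite !qapp_cls. apply tcls_eq, teq_S.
Defined.

Notation tenv e := (fun s n => tcls s (e s n)).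

Lemma ev_term_model e s (a : tm s) :
  ev term_model (tenv e) s a = tcls s (tsub e a).
Proof.
  induction a; simpl; auto. rewrite IHa1, IHa2. apply qapp_cls.
Qed.

(** The truth lemma. The quantifier case works because every class contains a term and the theory
    decides a universal formula by its term instances. *)
Lemma sat_term_model p : forall e, sat term_model (tenv e) p <-> H (fsub e p).
Proof.
  induction p; intros e; cbn [sat fsub].
  - rewrite !ev_term_model. apply tcls_eq.
  - rewrite !ev_term_model. simpl.
    split; apply H_lt; first [apply rpr_cls|apply teq_sym, rpr_cls];
      first [apply teq_refl|apply teq_sym|apply teq_trans].
  - split; [easy|apply H_fal].
  - rewrite H_imp, IHp1, IHp2. reflexivity.
  - rewrite H_all.
    assert (E : forall a, vcons (D := dom term_model) s (tcls s a) (tenv e)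
                          = tenv (scons a e)).
    { intros a. vc. apply (env_eq s).
      - now rewrite !vcons_0.
      - intros n. now rewrite !vcons_S.
      - intros t n N. now rewrite !vcons_ne by easy. }
    split.
    + intros X a. rewrite inst_up, <- IHp, <- E. apply X.
    + intros X x. destruct (tcls_surj _ x) as [a <-].
      rewrite E, IHp, <- inst_up. apply X.
Qed.

Lemma term_model_models : models term_model ACA0w.
Proof.
  intros p v A.
  assert (E : v = tenv (fun s n => rpr _ _ (v s n))).
  { extensionality s. extensionality n. symmetry. apply cls_rpr. }
  rewrite E. apply sat_term_model. now apply H_ax.
Qed.

End TermModel.

(** An unprovable formula is absent from its Henkin theory, hence false in the corresponding term
    model under the assignment of variables to their own classes. *)
Theorem completeness p :
  (forall M, models M ACA0w -> forall v, sat M v p) -> provable ACA0w p.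
Proof.
  intros S. apply NNPP. intros U. apply (hth_goal _ _ U).
  enough (X : hth ACA0w p (fsub ids p)) by now rewrite fsub_ids in X.
  apply (sat_term_model (hth ACA0w p) (hth_fal _ _ U) (hth_imp _ _ U)
    (hth_all _ _ U) (fun q e => hth_ax _ _ U q e)).
  apply S, term_model_models, (hth_fal _ _ U).
Qed.

(** * Definability in a model *)

Section Model.
Variable M : emodel.
Hypothesis HM : models M ACA0w.

Notation D := (dom M).
Notation N := (dom M ty0).
Notation "f $ x" := (app M f x) (at level 39, left associativity).

Definition addN (x y : N) : N := madd M $ x $ y.
Definition mulN (x y : N) : N := mmul M $ x $ y.
Notation "0" := (mzero M).
Notation "1" := (mone M).
Notation "x + y" := (addN x y).
Notation "x * y" := (mulN x y).
Notation "x < y" := (mlt M x y).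
Notation cst c := (mK M _ _ $ c).

Fixpoint inhabitant (s : ty) : D s :=
  match s with
  | ty0 => 0
  | Arr s t => cst (inhabitant t)
  end.

Notation v0 := (fun s (_ : nat) => inhabitant s).

Lemma cst_eq s t (c : D t) (x : D s) : cst c $ x = c.
Proof. apply mK_eq. Qed.

Lemma basic p : basic_axiom p -> sat M v0 (closed p).
Proof. intros B. now apply HM, ACA0w_RCA0w, RCA0w_basic. Qed.

Lemma addC x y : x + y = y + x.
Proof. exact (basic _ ax_addC x y). Qed.
Lemma addA x y z : x + (y + z) = x + y + z.
Proof. symmetry. exact (basic _ ax_addA x y z). Qed.
Lemma add0 x : x + 0 = x.
Proof. exact (basic _ ax_add0 x). Qed.
Lemma mulC x y : x * y = y * x.
Proof. exact (basic _ ax_mulC x y). Qed.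
Lemma mulA x y z : x * (y * z) = x * y * z.
Proof. symmetry. exact (basic _ ax_mulA x y z). Qed.
Lemma mul1 x : x * 1 = x.
Proof. exact (basic _ ax_mul1 x). Qed.
Lemma mul0 x : x * 0 = 0.
Proof. exact (basic _ ax_mul0 x). Qed.
Lemma mulD x y z : x * (y + z) = x * y + x * z.
Proof. exact (basic _ ax_mulD x y z). Qed.
Lemma lt_irr x : ~ x < x.
Proof. exact (basic _ ax_lt_irr x). Qed.
Lemma lt_trans x y z : x < y -> y < z -> x < z.
Proof. exact (basic _ ax_lt_trans x y z). Qed.
Lemma lt_total x y : x < y \/ x = y \/ y < x.
Proof.
  pose proof (basic _ ax_lt_total x y) as T. cbv in T. tauto.
Qed.
Lemma lt01 : 0 < 1.
Proof. exact (basic _ ax_lt01). Qed.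
Lemma lt_add x y z : x < y -> x + z < y + z.
Proof. exact (basic _ ax_lt_add x y z). Qed.

Lemma semiring : semi_ring_theory 0 1 addN mulN eq.
Proof.
  constructor; intros; rewrite ?addA, ?mulA; auto using addC, mulC.
  - now rewrite addC, add0.
  - now rewrite mulC, mul1.
  - now rewrite mulC, mul0.
  - now rewrite mulC, mulD, (mulC p), (mulC p).
Qed.

Add Ring Nring : semiring.

Lemma neq01 : 0 <> 1.
Proof. intros E. apply (lt_irr 0). rewrite E at 2. apply lt01. Qed.

Lemma rec0 f m : mrec M $ f $ m $ 0 = m.
Proof.
  pose proof (HM _ v0 (ACA0w_RCA0w RCA0w_rec) f m) as R. cbv in R. tauto.
Qed.

Lemma recS f m n : mrec M $ f $ m $ (n + 1) = f $ n $ (mrec M $ f $ m $ n).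
Proof.
  pose proof (HM _ v0 (ACA0w_RCA0w RCA0w_rec) f m) as R. cbv in R.
  apply NNPP. intros X. apply R. intros _ Y. exact (X (Y n)).
Qed.

(* [rep L F] says that [F] is given by an element of the model, curried; the
   last variable of the list [L] comes first. *)
Fixpoint env (L : list ty) : Type :=
  match L with
  | [] => unit
  | s :: L => (env L * D s)%type
  end.

Fixpoint arrs (L : list ty) (t : ty) : ty :=
  match L with
  | [] => t
  | s :: L => arrs L (Arr s t)
  end.

Fixpoint apps (L : list ty) t : D (arrs L t) -> env L -> D t :=
  match L with
  | [] => fun f _ => f
  | s :: L => fun f e => apps L (Arr s t) f (fst e) $ snd e
  end.

Definition rep (L : list ty) t (F : env L -> D t) : Prop :=
  exists f, forall e, apps L t f e = F e.
Arguments rep L {t} F.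

Lemma rep_ext L t (F G : env L -> D t) :
  rep L F -> (forall e, F e = G e) -> rep L G.
Proof. intros [f Hf] E. exists f. intros e. now rewrite Hf. Qed.

Lemma rep_const L t (c : D t) : rep L (fun _ => c).
Proof.
  revert t c. induction L as [|s L IH]; intros t c.
  - now exists c.
  - destruct (IH _ (cst c : D (Arr s t))) as [f Hf]. exists f.
    intros e. simpl. rewrite Hf. apply cst_eq.
Qed.

(** Bracket abstraction: [mS] passes the last argument to both parts, and the induction on [L]
    handles the others. *)
Lemma rep_app L s t (F : env L -> D (Arr s t)) (G : env L -> D s) :
  rep L F -> rep L G -> rep L (fun e => F e $ G e).
Proof.
  revert s t F G. induction L as [|r L IH]; intros s t F G [f Hf] [g Hg].
  - exists (f $ g). intros []. simpl. now rewrite <- Hf, <- Hg.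
  - destruct (IH _ _ _ _ (IH _ _ _ _ (rep_const L _ (mS M r s t))
      (ex_intro _ f (fun e => eq_refl))) (ex_intro _ g (fun e => eq_refl)))
      as [h Hh].
    exists h. intros e. simpl. rewrite Hh, mS_eq, <- Hf, <- Hg. reflexivity.
Qed.

(** The identity is [S K K]. *)
Lemma rep_v0 L s : rep (s :: L) (fun e => snd e).
Proof.
  destruct (rep_const L _ (mS M s _ s $ mK M s (Arr s s) $ mK M s s)) as [f Hf].
  exists f. intros e. simpl. now rewrite Hf, mS_eq, cst_eq.
Qed.

Lemma rep_wk L s t (F : env L -> D t) :
  rep L F -> rep (s :: L) (fun e => F (fst e)).
Proof.
  intros H. destruct (rep_app _ _ _ _ _ (rep_const L _ (mK M t s)) H) as [f Hf].
  exists f. intros e. simpl. now rewrite Hf, cst_eq.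
Qed.

(** Choice avoids carrying a definability proof inside terms. The value is meaningful when [F] is
    definable, possibly with parameters, as in [lam_eq] and [lam_open]. *)
Definition lam {s t} (F : D s -> D t) : D (Arr s t) :=
  epsilon (inhabits (inhabitant (Arr s t))) (fun f => forall x, f $ x = F x).

Lemma lam_eq s t (F : D s -> D t) x :
  rep [s] (fun e => F (snd e)) -> lam F $ x = F x.
Proof.
  intros [f Hf]. unfold lam. revert x. apply epsilon_spec.
  exists f. intros x. exact (Hf (tt, x)).
Qed.

Lemma lam_open L s t (F : env L -> D s -> D t) e x :
  rep (s :: L) (fun e => F (fst e) (snd e)) -> lam (F e) $ x = F e x.
Proof.
  intros [f Hf]. unfold lam. revert x. apply epsilon_spec.
  exists (apps L _ f e). intros x. exact (Hf (e, x)).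
Qed.

(** Extensionality identifies the chosen element with the one obtained uniformly from the
    representing element [f]. *)
Lemma rep_lam L s t (F : env L -> D s -> D t) :
  rep (s :: L) (fun e => F (fst e) (snd e)) -> rep L (fun e => lam (F e)).
Proof.
  intros H. pose proof H as [f Hf]. exists f. intros e.
  apply app_ext. intros x. rewrite (lam_open _ _ _ _ _ _ H).
  exact (Hf (e, x)).
Qed.

(** * Characteristic functions and decidable predicates *)

Definition chi (P : Prop) : N := if excluded_middle_informative P then 1 else 0.

Lemma chi_true (P : Prop) : P -> chi P = 1.
Proof. intros p. unfold chi. now destruct excluded_middle_informative. Qed.

Lemma chi_false (P : Prop) : ~ P -> chi P = 0.
Proof. intros p. unfold chi. now destruct excluded_middle_informative. Qed.

Lemma chi1 P : chi P = 1 <-> P.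
Proof.
  split; [|apply chi_true]. unfold chi.
  destruct excluded_middle_informative; auto. now intros E%neq01.
Qed.

Lemma chi0 P : chi P = 0 <-> ~ P.
Proof.
  split; [|apply chi_false]. intros E X. apply chi1 in X.
  rewrite X in E. now apply neq01.
Qed.

Lemma chi_iff P Q : (P <-> Q) -> chi P = chi Q.
Proof. intros E. f_equal. now apply propositional_extensionality. Qed.

Definition repP (L : list ty) (P : env L -> Prop) : Prop :=
  rep L (fun e => chi (P e)).

Lemma rep_chi L P : repP L P -> rep L (fun e => chi (P e)).
Proof. easy. Qed.

Lemma repP_ext L P Q : repP L P -> (forall e, P e <-> Q e) -> repP L Q.
Proof. intros H E. apply (rep_ext _ _ _ _ H). intros e. now apply chi_iff. Qed.

Lemma repP_const L (P : Prop) : repP L (fun _ => P).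
Proof. exact (rep_const _ _ (chi P)). Qed.

(** The primitive relations have characteristic functions by quantifier-free choice, applied to the
    statement that [y] is the truth value of the atom. The choice axiom has a single type 1
    argument, so the two numbers compared are its values at 0 and 1. *)
Lemma chi_eq_lt : exists Ye Yl : D ty2,
  forall x, Ye $ x = chi (x $ 0 = x $ 1) /\ Yl $ x = chi (x $ 0 < x $ 1).
Proof.
  set (B := fun b : bool => (if b then fEq else fLt)
    (tApp (tVar ty1 0) tZero) (tApp (tVar ty1 0) tOne)).
  set (A := fun b : bool => fNeg (fImp (fImp (B b) (fEq (tVar ty0 0) tOne))
    (fNeg (fImp (fNeg (B b)) (fEq (tVar ty0 0) tZero))))).
  assert (Q : forall b : bool, exists Y : D ty2, forall x,
      Y $ x = chi (if b then x $ 0 = x $ 1 else x $ 0 < x $ 1)).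
  { intros b. pose proof (HM (qfac_axiom (A b)) v0) as Q.
    assert (QA : qf (A b)) by (destruct b; cbn; tauto).
    specialize (Q (ACA0w_RCA0w (RCA0w_qfac QA))).
    apply NNPP. intros X. apply Q; clear Q.
    - intros x Y. apply (Y (chi (if b then x $ 0 = x $ 1 else x $ 0 < x $ 1))).
      destruct b; cbv -[chi app dom mzero mone mlt]; intros Z; apply Z;
        intros; [now apply chi_true|now apply chi_false|
                 now apply chi_true|now apply chi_false].
    - intros Y HY. apply X. exists Y. intros x. specialize (HY x).
      destruct b; cbv -[chi app dom mzero mone mlt] in HY |- *;
      apply NNPP; intros Z; apply HY; intros H1 H2; apply Z.
      + destruct (classic (x $ 0 = x $ 1)) as [E|E];
        [rewrite chi_true|rewrite chi_false]; auto.
      + destruct (classic (x $ 0 < x $ 1)) as [E|E];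
        [rewrite chi_true|rewrite chi_false]; auto. }
  destruct (Q true) as [Y1 H1], (Q false) as [Y2 H2]. exists Y1, Y2. auto.
Qed.

Lemma two_eq a b : let f := mrec M $ (cst (cst b)) $ a in f $ 0 = a /\ f $ 1 = b.
Proof.
  intros f. split; [apply rec0|].
  replace 1 with (0 + 1) by ring. unfold f. now rewrite recS, !cst_eq.
Qed.

Lemma rep_two L (F G : env L -> N) : rep L F -> rep L G ->
  rep L (fun e => mrec M $ (cst (cst (G e))) $ F e).
Proof. intros. repeat (apply rep_app; auto using rep_const). Qed.

Lemma repP_eq L (F G : env L -> N) :
  rep L F -> rep L G -> repP L (fun e => F e = G e).
Proof.
  intros HF HG. destruct chi_eq_lt as (Y & Y' & H).
  eapply rep_ext; [apply rep_app; [apply (rep_const _ _ Y)|]|].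
  - apply (rep_two L F G HF HG).
  - intros e. simpl. rewrite (proj1 (H _)).
    destruct (two_eq (F e) (G e)) as [-> ->]. reflexivity.
Qed.

Lemma repP_lt L (F G : env L -> N) :
  rep L F -> rep L G -> repP L (fun e => F e < G e).
Proof.
  intros HF HG. destruct chi_eq_lt as (Y' & Y & H).
  eapply rep_ext; [apply rep_app; [apply (rep_const _ _ Y)|]|].
  - apply (rep_two L F G HF HG).
  - intros e. simpl. rewrite (proj2 (H _)).
    destruct (two_eq (F e) (G e)) as [-> ->]. reflexivity.
Qed.

Lemma rep_add L F G : rep L F -> rep L G -> rep L (fun e => F e + G e).
Proof. intros. repeat (apply rep_app; auto using rep_const). Qed.

Lemma rep_mul L F G : rep L F -> rep L G -> rep L (fun e => F e * G e).
Proof. intros. repeat (apply rep_app; auto using rep_const). Qed.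

Lemma repP_not L P : repP L P -> repP L (fun e => ~ P e).
Proof.
  intros H. apply repP_ext with (fun e => chi (P e) = 0).
  - apply repP_eq; auto using rep_const.
  - intros e. apply chi0.
Qed.

Lemma repP_and L P Q : repP L P -> repP L Q -> repP L (fun e => P e /\ Q e).
Proof.
  intros HP HQ. apply repP_ext with (fun e => chi (P e) * chi (Q e) = 1).
  - apply repP_eq; auto using rep_const, rep_mul.
  - intros e. destruct (classic (P e)) as [X|X], (classic (Q e)) as [Y|Y].
    + rewrite !chi_true by auto. split; auto. intros _. ring.
    + rewrite (chi_false (Q e)), mul0 by auto. split; [|easy]. now intros E%neq01.
    + rewrite (chi_false (P e)), mulC, mul0 by auto. split; [|easy].
      now intros E%neq01.
    + rewrite (chi_false (P e)), mulC, mul0 by auto. split; [|easy].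
      now intros E%neq01.
Qed.

Lemma repP_or L P Q : repP L P -> repP L Q -> repP L (fun e => P e \/ Q e).
Proof.
  intros HP HQ. apply repP_ext with (fun e => ~ (~ P e /\ ~ Q e)).
  - auto using repP_not, repP_and.
  - intros e. tauto.
Qed.

Lemma repP_imp L P Q : repP L P -> repP L Q -> repP L (fun e => P e -> Q e).
Proof.
  intros HP HQ. apply repP_ext with (fun e => ~ (P e /\ ~ Q e)).
  - auto using repP_not, repP_and.
  - intros e. tauto.
Qed.

Lemma repP_iff L P Q : repP L P -> repP L Q -> repP L (fun e => P e <-> Q e).
Proof. intros. apply repP_and; now apply repP_imp. Qed.

(** * Number quantifiers and choice of numbers *)

Lemma mu_ex : exists mu : D ty2, forall f : D ty1,
  ((exists n, f $ n = 0) -> f $ (mu $ f) = 0) /\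
  ((forall n, f $ n <> 0) -> mu $ f = 0).
Proof.
  pose proof (HM _ v0 ACA0w_mu) as H. apply NNPP. intros X. apply H.
  intros mu Hmu. apply X. exists mu. intros f. specialize (Hmu f).
  cbv -[app dom mzero mone mlt] in Hmu. split.
  - intros [n Hn]. apply NNPP. intros Y. apply Hmu. intros Z _.
    apply Z; [intros W; now apply (W n)|]. tauto.
  - intros Hn. apply NNPP. intros Y. apply Hmu. tauto.
Qed.

Definition mu : D ty2 := proj1_sig (constructive_indefinite_description _ mu_ex).

Lemma mu_spec (f : D ty1) n : f $ n = 0 -> f $ (mu $ f) = 0.
Proof.
  unfold mu. destruct constructive_indefinite_description as [m Hm]. simpl.
  intros E. apply Hm. now exists n.
Qed.

Lemma mu_zero (f : D ty1) : (forall n, f $ n <> 0) -> mu $ f = 0.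
Proof.
  unfold mu. destruct constructive_indefinite_description as [m Hm]. apply Hm.
Qed.

(** Applied to the characteristic function of [P e], [mu] returns a counterexample whenever one
    exists; so the truth of [P e] at this one number decides the quantifier. *)
Lemma repP_all L (P : env L -> N -> Prop) :
  repP (ty0 :: L) (fun e => P (fst e) (snd e)) -> repP L (fun e => forall n, P e n).
Proof.
  intros H. set (g e := lam (fun n => chi (P e n)) : D ty1).
  assert (Hg : forall e n, g e $ n = chi (P e n)).
  { intros e n. exact (lam_open L ty0 ty0 (fun e n => chi (P e n)) e n H). }
  apply repP_ext with (fun e => g e $ (mu $ g e) = 1).
  - assert (R : rep L g) by exact (rep_lam L _ _ _ H).
    apply repP_eq; auto using rep_const, rep_app.
  - intros e. rewrite Hg, chi1. split; auto. intros Hm n.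
    apply NNPP. intros X. apply chi0 in X. rewrite <- Hg in X.
    apply mu_spec in X. rewrite Hg, chi0 in X. auto.
Qed.

Lemma repP_ex L (P : env L -> N -> Prop) :
  repP (ty0 :: L) (fun e => P (fst e) (snd e)) -> repP L (fun e => exists n, P e n).
Proof.
  intros H. apply repP_ext with (fun e => ~ forall n, ~ P e n).
  - apply repP_not, (repP_all L (fun e n => ~ P e n)). now apply repP_not.
  - intros e. split.
    + apply not_all_not_ex.
    + intros [n Hn] X. exact (X n Hn).
Qed.

Definition ite (P : Prop) (a b : N) : N :=
  if excluded_middle_informative P then a else b.

Lemma ite_true P a b : P -> ite P a b = a.
Proof. intros p. unfold ite. now destruct excluded_middle_informative. Qed.

Lemma ite_false P a b : ~ P -> ite P a b = b.
Proof. intros p. unfold ite. now destruct excluded_middle_informative. Qed.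

Lemma rep_ite L P F G : repP L P -> rep L F -> rep L G ->
  rep L (fun e => ite (P e) (F e) (G e)).
Proof.
  intros HP HF HG.
  apply rep_ext with (fun e => chi (P e) * F e + chi (~ P e) * G e).
  - apply rep_add; apply rep_mul; auto. now apply repP_not.
  - intros e. destruct (classic (P e)) as [X|X].
    + rewrite ite_true, chi_true, chi_false by tauto. ring.
    + rewrite ite_false, chi_false, chi_true by tauto. ring.
Qed.

(** A zero of the characteristic function of the complement is an element of [P]. If there is none
    the value is 0, a default on which the coding of sequences relies. *)
Definition sel (P : N -> Prop) : N := mu $ lam (fun n => chi (~ P n)).

Lemma rep_sel L (P : env L -> N -> Prop) :
  repP (ty0 :: L) (fun e => P (fst e) (snd e)) -> rep L (fun e => sel (P e)).
Proof.
  intros H. apply rep_app; [apply rep_const|].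
  apply (rep_lam L _ _ (fun e n => chi (~ P e n))). now apply repP_not.
Qed.

Lemma sel_spec (P : N -> Prop) n :
  repP [ty0] (fun e => P (snd e)) -> P n -> P (sel P).
Proof.
  intros R Hn. apply repP_not in R.
  assert (E : forall n, lam (fun n => chi (~ P n)) $ n = chi (~ P n)).
  { intros m. now apply (lam_eq ty0 ty0 (fun n => chi (~ P n))). }
  apply NNPP. intros X. apply chi1 in X. revert X. unfold sel.
  rewrite <- E. erewrite mu_spec; [apply neq01|].
  rewrite E. apply chi0. intros Y. exact (Y Hn).
Qed.

Lemma sel_none (P : N -> Prop) :
  repP [ty0] (fun e => P (snd e)) -> (forall n, ~ P n) -> sel P = 0.
Proof.
  intros R Hn. apply repP_not in R. apply mu_zero. intros n.
  rewrite (lam_eq ty0 ty0 (fun n => chi (~ P n)) n R), chi_true by auto.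
  intros E. symmetry in E. now apply neq01.
Qed.

(** [rp] proves definability by following the syntax, with one closure property per construct; the
    quantifiers it treats range over type 0. *)
Ltac rp_var pf := first [exact pf | rp_var uconstr:(rep_wk _ _ _ _ pf)].
Ltac rp_step :=
  cbv beta;
  first [simple apply repP_const | simple apply rep_const |
  lazymatch goal with
  | |- rep _ snd => exact (rep_v0 _ _)
  | |- rep _ (fun e => snd _) => rp_var uconstr:(rep_v0 _ _)
  | |- rep _ (fun e => app M _ _) => apply rep_app
  | |- rep _ (fun e => addN _ _) => apply rep_add
  | |- rep _ (fun e => mulN _ _) => apply rep_mul
  | |- rep _ (fun e => chi _) => apply rep_chi
  | |- rep _ (fun e => lam _) => apply rep_lam
  | |- rep _ (fun e => ite _ _ _) => apply rep_ite
  | |- rep _ (fun e => sel _) => apply rep_sel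
  | |- repP _ (fun e => _ = _) => apply repP_eq
  | |- repP _ (fun e => mlt M _ _) => apply repP_lt
  | |- repP _ (fun e => ~ _) => apply repP_not
  | |- repP _ (fun e => _ /\ _) => apply repP_and
  | |- repP _ (fun e => _ \/ _) => apply repP_or
  | |- repP _ (fun e => _ <-> _) => apply repP_iff
  | |- repP _ (fun e => exists n, _) => apply repP_ex
  | |- repP _ (fun e => forall n : dom M ty0, _) => apply repP_all
  | |- repP _ (fun e => _ -> _) => apply repP_imp
  end].
Create HintDb definable.
Ltac rp := autounfold with definable; repeat rp_step.

(** The induction axioms concern quantifier-free formulas, so [P] enters through its characteristic
    function, taken as a type 1 parameter. This gives induction for every arithmetical property. *)
Lemma induction_on (P : N -> Prop) :
  repP [ty0] (fun e => P (snd e)) ->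
  P 0 -> (forall n, P n -> P (n + 1)) -> forall n, P n.
Proof.
  intros R H0 HS. set (f := lam (fun n => chi (P n)) : D ty1).
  assert (E : forall n, f $ n = 1 <-> P n).
  { intros n. unfold f. rewrite (lam_eq ty0 ty0 (fun n => chi (P n)) n R).
    apply chi1. }
  set (A := fEq (tApp (tVar ty1 0) (tVar ty0 0)) tOne).
  pose proof (HM (induction_axiom A) (fun s n => vcons ty1 f v0 s n)
    (ACA0w_RCA0w (@RCA0w_induction A I))) as X.
  assert (X' : f $ 0 = 1 -> (forall n, f $ n = 1 -> f $ (n + 1) = 1) ->
               forall n, f $ n = 1) by exact X.
  intros n. apply E. apply X'.
  - now apply E.
  - intros m Hm. now apply E, HS, E.
Qed.

(** * Arithmetic in a model *)

Ltac ind n := pattern n; apply induction_on; clear n; [rp|..].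

Lemma zero_or_succ n : n = 0 \/ exists m, n = m + 1.
Proof. ind n; auto. intros n _. right. now exists n. Qed.

Lemma lt0_succ n : 0 < n + 1.
Proof.
  ind n.
  - replace (0 + 1) with 1 by ring. apply lt01.
  - intros n IH. apply lt_trans with 1; [apply lt01|].
    replace 1 with (0 + 1) at 1 by ring. now apply lt_add.
Qed.

Lemma succ_ne0 n : n + 1 <> 0.
Proof. intros E. apply (lt_irr 0). rewrite <- E at 2. apply lt0_succ. Qed.

Lemma add_cancel x y z : x + z = y + z -> x = y.
Proof.
  intros E. destruct (lt_total x y) as [L|[L|L]]; auto;
    apply lt_add with (z := z) in L; rewrite E in L; now apply lt_irr in L.
Qed.

Lemma add_succ_ne x c : x + c + 1 <> x.
Proof.
  intros E. apply (succ_ne0 c). apply add_cancel with x.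
  transitivity x; [rewrite <- E at 2|]; ring.
Qed.

Lemma lt_diff b : forall a, a < b -> exists c, b = a + c + 1.
Proof.
  ind b.
  - intros a H. destruct (zero_or_succ a) as [->|[m ->]].
    + now apply lt_irr in H.
    + destruct (lt_irr 0). eapply lt_trans; [apply lt0_succ|exact H].
  - intros b IH a H. destruct (zero_or_succ a) as [->|[m ->]].
    + exists b. ring.
    + destruct (lt_total m b) as [L|[->|L]].
      * destruct (IH _ L) as [c ->]. exists c. ring.
      * now apply lt_irr in H.
      * apply lt_add with (z := 1) in L. destruct (lt_irr (b + 1)).
        eapply lt_trans; eassumption.
Qed.

(** Expressing the order by differences turns inequalities into equations that [ring] can treat. *)
Lemma compare a b :
  a = b \/ (exists c, b = a + c + 1) \/ (exists c, a = b + c + 1).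
Proof. destruct (lt_total a b) as [L|[L|L]]; auto using lt_diff. Qed.

(* The shift by [1] makes both components smaller than the code, and leaves [0]
   without components. *)
Definition pair (a b : N) : N := (a + b) * (a + b) + a + 1.

(** With [s = a + b], the code lies strictly above the square of [s] and at most at the square of
    [s + 1], so different sums give disjoint ranges of codes. *)
Lemma pair_sum a b a' b' : pair a b = pair a' b' -> a + b = a' + b'.
Proof.
  assert (S : forall a b a' b' c, a' + b' = a + b + c + 1 ->
              pair a b <> pair a' b').
  { unfold pair. clear - HM. intros a b a' b' c E H. rewrite E in H.
    apply (add_succ_ne ((a + b) * (a + b) + a + 1)
      ((a + b) * (c + c + 1) + b + (c + 1) * c + c + a')).
    rewrite H at 2. ring. }
  intros H. destruct (compare (a + b) (a' + b')) as [|[[c E]|[c E]]]; auto.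
  - now destruct (S _ _ _ _ _ E).
  - now destruct (S _ _ _ _ _ E).
Qed.

Lemma pair_inj a b a' b' : pair a b = pair a' b' -> a = a' /\ b = b'.
Proof.
  intros H. pose proof (pair_sum _ _ _ _ H) as E.
  assert (a = a').
  { unfold pair in H. rewrite E in H.
    apply add_cancel with ((a' + b') * (a' + b') + 1).
    transitivity ((a' + b') * (a' + b') + a + 1); [ring|]. rewrite H. ring. }
  split; auto. subst. apply add_cancel with a'. now rewrite !(addC _ a').
Qed.

Definition fstN (t : N) : N := sel (fun a => exists b, t = pair a b).
Definition sndN (t : N) : N := sel (fun b => exists a, t = pair a b).

Lemma rep_comp L s t (F : D s -> D t) (G : env L -> D s) :
  rep [s] (fun e => F (snd e)) -> rep L G -> rep L (fun e => F (G e)).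
Proof.
  intros [f Hf] HG. apply rep_ext with (fun e => f $ G e).
  - apply rep_app; auto using rep_const.
  - intros e. exact (Hf (tt, G e)).
Qed.

Lemma rep_comp2 L r s t (F : D r -> D s -> D t) (G : env L -> D r)
  (H : env L -> D s) : rep [s; r] (fun e => F (snd (fst e)) (snd e)) ->
  rep L G -> rep L H -> rep L (fun e => F (G e) (H e)).
Proof.
  intros [f Hf] HG HH. apply rep_ext with (fun e => f $ G e $ H e).
  - repeat apply rep_app; auto using rep_const.
  - intros e. exact (Hf (tt, G e, H e)).
Qed.

#[local] Hint Unfold pair fstN sndN : definable.

Lemma fstN_pair a b : fstN (pair a b) = a.
Proof.
  assert (X : exists b', pair a b = pair (fstN (pair a b)) b').
  { unfold fstN at 1.
    apply (sel_spec (fun x => exists b', pair a b = pair x b') a); [rp|].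
    now exists b. }
  destruct X as [b' X]. now apply pair_inj in X.
Qed.

Lemma sndN_pair a b : sndN (pair a b) = b.
Proof.
  assert (X : exists a', pair a b = pair a' (sndN (pair a b))).
  { unfold sndN at 1.
    apply (sel_spec (fun x => exists a', pair a b = pair a' x) b); [rp|].
    now exists a. }
  destruct X as [b' X]. now apply pair_inj in X.
Qed.

Lemma sndN_small u : sndN u = 0 \/ exists d, sndN u + 1 + d = u.
Proof.
  destruct (classic (exists b a, u = pair a b)) as [(b & a & ->)|X].
  - rewrite sndN_pair. unfold pair.
    destruct (zero_or_succ b) as [->|[m ->]]; auto. right.
    exists ((a + m) * (a + m) + (a + a) + m + a). ring.
  - left. unfold sndN. apply sel_none; [rp|]. firstorder.
Qed.

Lemma fstN_0 : fstN 0 = 0.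
Proof.
  unfold fstN. apply sel_none; [rp|]. intros a [b E]. symmetry in E.
  now apply succ_ne0 in E.
Qed.

(* The number [t] codes a finitely supported sequence with [n]-th entry
   [coord n t]. *)
Definition tailN (n t : N) : N := mrec M $ cst (lam sndN) $ t $ n.
Definition coord (n t : N) : N := fstN (tailN n t).

#[local] Hint Unfold tailN coord : definable.

Lemma lam_sndN x : lam sndN $ x = sndN x.
Proof. apply (lam_eq ty0 ty0 sndN). rp. Qed.

Lemma tailN_0 t : tailN 0 t = t.
Proof. apply rec0. Qed.

Lemma tailN_succ n t : tailN (n + 1) t = sndN (tailN n t).
Proof. unfold tailN. now rewrite recS, cst_eq, lam_sndN. Qed.

Lemma tailN_shift n t : tailN (n + 1) t = tailN n (sndN t).
Proof.
  ind n.
  - now rewrite tailN_succ, !tailN_0.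
  - intros n IH. now rewrite tailN_succ, IH, tailN_succ.
Qed.

Lemma coord_0 t : coord 0 t = fstN t.
Proof. unfold coord. now rewrite tailN_0. Qed.

Lemma coord_succ n t : coord (n + 1) t = coord n (sndN t).
Proof. unfold coord. now rewrite tailN_shift. Qed.

(** By [sndN_small] every step either reaches 0 or lowers the code by at least one. Hence a code [t]
    has no nonzero entry beyond position [t]. *)
Lemma tailN_small t n : tailN n t = 0 \/ exists c, tailN n t + n + c = t.
Proof.
  ind n.
  - right. exists 0. rewrite tailN_0. ring.
  - intros n IH. rewrite tailN_succ.
    destruct (sndN_small (tailN n t)) as [E|[d E]]; auto.
    destruct IH as [IH|[c IH]].
    + rewrite IH in *. left. destruct (succ_ne0 (sndN 0 + d)).
      rewrite <- E at 2. ring.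
    + right. exists (d + c). transitivity (tailN n t + n + c); auto.
      transitivity (sndN (tailN n t) + 1 + d + n + c); [ring|now rewrite E].
Qed.

Lemma coord_large t n : coord (t + 1 + n) t = 0.
Proof.
  unfold coord. destruct (tailN_small t (t + 1 + n)) as [->|[c E]].
  - apply fstN_0.
  - destruct (add_succ_ne t (tailN (t + 1 + n) t + n + c)).
    etransitivity; [|exact E]. ring.
Qed.

Lemma coord_of_0 n : coord n 0 = 0.
Proof.
  destruct (zero_or_succ n) as [->|[m ->]].
  - rewrite coord_0. apply fstN_0.
  - replace (m + 1) with (0 + 1 + m) by ring. apply coord_large.
Qed.

Lemma coord_surj (z : D ty1) b : (forall n, z $ (b + n) = 0) ->
  exists t, forall n, coord n t = z $ n.
Proof.
  intros Hz.
  (* The code is built from the back: [j] counts the positions from [k] up to the bound [b], and 0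
     codes the empty remainder. *)
  assert (X : forall j k, k + j = b -> exists t, forall n, coord n t = z $ (k + n)).
  { intros j. ind j.
    - intros k E. exists 0. intros n. rewrite coord_of_0, <- (Hz n), <- E.
      f_equal. ring.
    - intros j IH k E. destruct (IH (k + 1)) as [t Ht]; [rewrite <- E; ring|].
      exists (pair (z $ k) t). intros n.
      destruct (zero_or_succ n) as [->|[m ->]].
      + rewrite coord_0, fstN_pair. f_equal. ring.
      + rewrite coord_succ, sndN_pair, Ht. f_equal. ring. }
  destruct (X b 0) as [t Ht]; [ring|]. exists t. intros n. rewrite Ht.
  f_equal. ring.
Qed.

(** The Chinese remainder coefficients for the moduli [k + 1] and [k], found without subtraction:
    [k * k] is 1 modulo [k + 1] and 0 modulo [k], and [k + 1] is 0 and 1 respectively. *)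
Lemma coord_comb t t' k : exists t'', forall n,
  coord n t'' = k * k * coord n t + (k + 1) * coord n t'.
Proof.
  set (F := fun n => k * k * coord n t + (k + 1) * coord n t').
  assert (E : forall n, lam F $ n = F n).
  { intros n. apply (lam_eq ty0 ty0 F). unfold F. rp. }
  destruct (coord_surj (lam F) (t + t' + 1)) as [u Hu].
  - intros n. rewrite E. unfold F.
    replace (t + t' + 1 + n) with (t + 1 + (t' + n)) at 1 by ring.
    replace (t + t' + 1 + n) with (t' + 1 + (t + n)) by ring.
    rewrite !coord_large. ring.
  - exists u. intros n. now rewrite Hu, E.
Qed.

Lemma coord_unit m : exists t,
  coord m t = 1 /\ forall n, n <> m -> coord n t = 0.
Proof.
  set (F := fun n => chi (n = m)).
  assert (E : forall n, lam F $ n = F n).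
  { intros n. apply (lam_eq ty0 ty0 F). unfold F. rp. }
  destruct (coord_surj (lam F) (m + 1)) as [u Hu].
  - intros n. rewrite E. apply chi_false. intros X.
    apply (add_succ_ne m n). rewrite <- X at 2. ring.
  - exists u. split.
    + rewrite Hu, E. now apply chi_true.
    + intros n Hn. rewrite Hu, E. now apply chi_false.
Qed.

(** * Integers of a model *)

Definition zeqv (x y : N * N) : Prop := fst x + snd y = fst y + snd x.

Lemma zeqv_refl x : zeqv x x.
Proof. reflexivity. Qed.

Lemma zeqv_sym x y : zeqv x y -> zeqv y x.
Proof. now unfold zeqv. Qed.

Lemma zeqv_trans x y z : zeqv x y -> zeqv y z -> zeqv x z.
Proof.
  destruct x as [a b], y as [c d], z as [e f]. unfold zeqv. simpl.
  intros H1 H2. apply add_cancel with d. transitivity (a + d + f); [ring|].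
  rewrite H1. transitivity (c + f + b); [ring|]. rewrite H2. ring.
Qed.

Definition Zm : Type := quot (N * N) zeqv.
Definition mk (a b : N) : Zm := cls (N * N) zeqv (a, b).

Lemma mk_eq a b c d : mk a b = mk c d <-> a + d = c + b.
Proof. apply (cls_eq _ zeqv zeqv_refl zeqv_sym zeqv_trans). Qed.

Lemma mk_surj z : exists a b, z = mk a b.
Proof.
  exists (fst (rpr _ _ z)), (snd (rpr _ _ z)). unfold mk.
  rewrite <- surjective_pairing. symmetry. apply cls_rpr.
Qed.

Definition zlift (f : N * N -> N * N -> N * N) (x y : Zm) : Zm :=
  cls _ zeqv (f (rpr _ _ x) (rpr _ _ y)).

Definition addp (x y : N * N) : N * N := (fst x + fst y, snd x + snd y).
Definition mulp (x y : N * N) : N * N :=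
  (fst x * fst y + snd x * snd y, fst x * snd y + snd x * fst y).

(** For a symmetric operation, compatibility in the first argument suffices. *)
Lemma zlift_cls f x y :
  (forall x x' y, zeqv x x' -> zeqv (f x y) (f x' y)) ->
  (forall x y, f x y = f y x) ->
  zlift f (cls _ zeqv x) (cls _ zeqv y) = cls _ zeqv (f x y).
Proof.
  intros Hf Cf.
  pose proof (rpr_cls _ _ zeqv_refl zeqv_sym zeqv_trans) as R.
  apply (cls_eq _ zeqv zeqv_refl zeqv_sym zeqv_trans).
  eapply zeqv_trans; [apply Hf, R|]. rewrite !(Cf x). apply Hf, R.
Qed.

Definition zadd : Zm -> Zm -> Zm := zlift addp.
Definition zmul : Zm -> Zm -> Zm := zlift mulp.

Lemma zadd_mk a b c d : zadd (mk a b) (mk c d) = mk (a + c) (b + d).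
Proof.
  apply (zlift_cls addp); unfold addp, zeqv; simpl.
  - intros [a1 b1] [a2 b2] [a3 b3]. simpl. intros E.
    transitivity (a1 + b2 + (a3 + b3)); [ring|]. rewrite E. ring.
  - intros. f_equal; apply addC.
Qed.

Lemma zmul_mk a b c d : zmul (mk a b) (mk c d) = mk (a * c + b * d) (a * d + b * c).
Proof.
  apply (zlift_cls mulp); unfold mulp, zeqv; simpl.
  - intros [a1 b1] [a2 b2] [a3 b3]. simpl. intros E.
    transitivity ((a1 + b2) * a3 + (a2 + b1) * b3); [ring|]. rewrite E.
    transitivity ((a2 + b1) * a3 + (a1 + b2) * b3); [rewrite E|]; ring.
  - intros [a1 b1] [a2 b2]. simpl. f_equal; ring.
Qed.

(** Negation as multiplication by -1 makes its properties instances of those of the product. *)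
Definition zopp (x : Zm) : Zm := zmul (mk 0 1) x.

Lemma zopp_mk a b : zopp (mk a b) = mk b a.
Proof. unfold zopp. rewrite zmul_mk. f_equal; ring. Qed.

Definition zsub (x y : Zm) : Zm := zadd x (zopp y).

Lemma zring : ring_theory (mk 0 0) (mk 1 0) zadd zmul zsub zopp eq.
Proof.
  constructor; intros;
    repeat match goal with
    | x : Zm |- _ => destruct (mk_surj x) as (? & ? & ->); clear x
    end; unfold zsub; rewrite ?zopp_mk, ?zmul_mk, ?zadd_mk, ?zmul_mk;
    try reflexivity; apply mk_eq; ring.
Qed.

Add Ring Zring : zring.

Definition zof (n : N) : Zm := mk n 0.

Lemma mk_ne0 a b : mk a b <> mk 0 0 <-> a <> b.
Proof.
  rewrite mk_eq. split; intros H E; apply H.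
  - rewrite E. ring.
  - apply add_cancel with 0. now rewrite E, addC.
Qed.

Lemma zmul_eq0 x y : zmul x y = mk 0 0 -> x = mk 0 0 \/ y = mk 0 0.
Proof.
  destruct (mk_surj x) as (a & b & ->), (mk_surj y) as (c & d & ->).
  rewrite zmul_mk, !mk_eq. intros E.
  destruct (compare a b) as [->|[[e ->]|[e ->]]]; [left; ring|..];
  destruct (compare c d) as [->|[[f ->]|[f ->]]]; try (right; ring);
  exfalso.
  (* In each of the four sign cases the two sides of [E] differ by [(e + 1) * (f + 1)], which is
     positive. *)
  - apply (add_succ_ne (a * (c + f + 1) + (a + e + 1) * c) (e * f + e + f)).
    transitivity (0 + (a * (c + f + 1) + (a + e + 1) * c)); [|ring].
    rewrite <- E. ring.
  - apply (add_succ_ne (a * (d + f + 1) + (a + e + 1) * d) (e * f + e + f)).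
    transitivity (a * d + (a + e + 1) * (d + f + 1) + 0); [ring|].
    symmetry. transitivity (a * (d + f + 1) + (a + e + 1) * d + 0); [ring|].
    rewrite E. ring.
  - apply (add_succ_ne ((b + e + 1) * c + b * (c + f + 1)) (e * f + e + f)).
    transitivity (0 + ((b + e + 1) * (c + f + 1) + b * c)); [ring|].
    rewrite <- E. ring.
  - apply (add_succ_ne ((b + e + 1) * d + b * (d + f + 1)) (e * f + e + f)).
    transitivity ((b + e + 1) * (d + f + 1) + b * d + 0); [ring|].
    rewrite E. ring.
Qed.

(** The modulus exceeds [a + b], hence the absolute value of the nonzero integer [a - b]. *)
Lemma zof_multiple a b c y :
  mk a b <> mk 0 0 -> mk a b <> zmul (zof (a + b + c + 1)) y.
Proof.
  rewrite mk_ne0. intros H. destruct (mk_surj y) as (p & q & ->).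
  unfold zof. rewrite zmul_mk, mk_eq. intros E. apply H.
  set (k := a + b + c + 1) in *.
  destruct (compare p q) as [->|[[e ->]|[e ->]]].
  - apply add_cancel with (k * q). transitivity (a + (k * q + 0 * q)); [ring|].
    rewrite E. ring.
  - destruct (add_succ_ne b (a + a + k * e + c)).
    apply add_cancel with (k * p).
    transitivity (a + (k * (p + e + 1) + 0 * p)); [unfold k; ring|].
    rewrite E. ring.
  - destruct (add_succ_ne a (b + b + k * e + c)).
    apply add_cancel with (k * q).
    transitivity (k * (q + e + 1) + 0 * q + b); [unfold k; ring|].
    rewrite <- E. ring.
Qed.

Notation "x +z y" := (zadd x y) (at level 50, left associativity).
Notation "x *z y" := (zmul x y) (at level 40, left associativity).
Notation z0 := (mk 0 0).
Notation z1 := (mk 1 0).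

(** Multiples of [m] are added on both sides for lack of subtraction. *)
Definition congruent (m t t' : N) : Prop :=
  forall n, exists c c', coord n t + m * c = coord n t' + m * c'.

(* Polynomials in the coordinates have this property. *)
Definition congruence_preserving (u : N -> Zm) : Prop :=
  forall m t t', congruent m t t' -> exists z, u t = u t' +z zof m *z z.

Lemma cp_const c : congruence_preserving (fun _ => c).
Proof. intros m t t' _. exists z0. ring. Qed.

Lemma cp_add u v : congruence_preserving u -> congruence_preserving v ->
  congruence_preserving (fun t => u t +z v t).
Proof.
  intros Hu Hv m t t' C. destruct (Hu _ _ _ C) as [x ->], (Hv _ _ _ C) as [y ->].
  exists (x +z y). ring.
Qed.

Lemma cp_mul u v : congruence_preserving u -> congruence_preserving v ->
  congruence_preserving (fun t => u t *z v t).
Proof.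
  intros Hu Hv m t t' C. destruct (Hu _ _ _ C) as [x ->], (Hv _ _ _ C) as [y ->].
  exists (u t' *z y +z x *z v t' +z zof m *z x *z y). ring.
Qed.

Lemma cp_opp u : congruence_preserving u ->
  congruence_preserving (fun t => zopp (u t)).
Proof. intros H. apply (cp_mul (fun _ => mk 0 1)); auto. apply cp_const. Qed.

Lemma cp_coord n : congruence_preserving (fun t => zof (coord n t)).
Proof.
  intros m t t' C. destruct (C n) as (c & c' & E). exists (mk c' c).
  unfold zof. rewrite zmul_mk, zadd_mk, mk_eq.
  transitivity (coord n t + m * c); [ring|]. rewrite E. ring.
Qed.

(* By the Chinese remainder theorem some [t''] is congruent to [t] modulo [k + 1]
   and to [t'] modulo [k], where [k] exceeds both nonzero values. *)
Lemma cp_nonzero_mul u v (S : N -> Prop) t t' :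
  congruence_preserving u -> congruence_preserving v ->
  (forall n, ~ S n -> coord n t = 0) -> (forall n, ~ S n -> coord n t' = 0) ->
  u t <> z0 -> v t' <> z0 ->
  exists t'', (forall n, ~ S n -> coord n t'' = 0) /\ u t'' *z v t'' <> z0.
Proof.
  intros Cu Cv St St' Nu Nv.
  destruct (mk_surj (u t)) as (a & b & Eu), (mk_surj (v t')) as (c & d & Ev).
  (* The two moduli are [j + 1] and [j + 2], both larger than [a + b] and [c + d]. *)
  set (j := a + b + (c + d)).
  destruct (coord_comb t t' (j + 1)) as [s Hs]. exists s. split.
  - intros n Hn. rewrite Hs, St, St' by auto. ring.
  - intros E. apply zmul_eq0 in E as [E|E].
    + destruct (Cu (j + 1 + 1) t s) as [z Hz].
      (* With [k = j + 1], the square of [k] is [1 + (k + 1) * j], so the combination is [t] plus a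
         multiple of [k + 1]. *)
      * intros n. exists (j * coord n t + coord n t'), 0. rewrite Hs. ring.
      * rewrite Eu in *. apply (zof_multiple a b (c + d + 1) z Nu).
        rewrite Hz, E. unfold j.
        replace (a + b + (c + d) + 1 + 1) with (a + b + (c + d + 1) + 1) by ring.
        ring.
    + destruct (Cv (j + 1) t' s) as [z Hz].
      * intros n. exists ((j + 1) * coord n t + coord n t'), 0. rewrite Hs. ring.
      * rewrite Ev in *. apply (zof_multiple c d (a + b) z Nv).
        rewrite Hz, E. unfold j.
        replace (a + b + (c + d) + 1) with (c + d + (a + b) + 1) by ring. ring.
Qed.

(** * The statements in a model *)

Definition mmem {s} (x : D s) (X : D (Arr s ty0)) : Prop := X $ x = 1.
Definition mset {s} (X : D (Arr s ty0)) : Prop :=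
  forall x, X $ x = 0 \/ X $ x = 1.

Section RingStatements.
Variables (A : D ty2) (zero one : D ty1) (eqR : D (Arr ty1 (Arr ty1 ty0)))
  (add mul : D (Arr ty1 (Arr ty1 ty1))) (opp : D (Arr ty1 ty1)).
Notation "x =R y" := (eqR $ x $ y = 1) (at level 70).
Notation "x +R y" := (add $ x $ y) (at level 50, left associativity).
Notation "x *R y" := (mul $ x $ y) (at level 40, left associativity).
Notation "-R x" := (opp $ x) (at level 35, right associativity).
Notation "x 'in_A'" := (mmem x A) (at level 70).

Definition m_comm_ring : Prop :=
  mset A /\ (forall x, mset (eqR $ x)) /\ zero in_A /\ one in_A /\
  (forall x, x in_A -> forall y, y in_A -> x +R y in_A) /\
  (forall x, x in_A -> -R x in_A) /\
  (forall x, x in_A -> forall y, y in_A -> x *R y in_A) /\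
  (forall x, x in_A -> x =R x) /\
  (forall x, x in_A -> forall y, y in_A -> x =R y -> y =R x) /\
  (forall x, x in_A -> forall y, y in_A -> forall z, z in_A ->
     x =R y -> y =R z -> x =R z) /\
  (forall x, x in_A -> forall x', x' in_A ->
   forall y, y in_A -> forall y', y' in_A ->
     x =R x' -> y =R y' -> x +R y =R x' +R y') /\
  (forall x, x in_A -> forall x', x' in_A -> x =R x' -> -R x =R -R x') /\
  (forall x, x in_A -> forall x', x' in_A ->
   forall y, y in_A -> forall y', y' in_A ->
     x =R x' -> y =R y' -> x *R y =R x' *R y') /\
  (forall x, x in_A -> forall y, y in_A -> forall z, z in_A ->
     (x +R y) +R z =R x +R (y +R z)) /\
  (forall x, x in_A -> forall y, y in_A -> x +R y =R y +R x) /\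
  (forall x, x in_A -> x +R zero =R x) /\
  (forall x, x in_A -> x +R -R x =R zero) /\
  (forall x, x in_A -> forall y, y in_A -> forall z, z in_A ->
     (x *R y) *R z =R x *R (y *R z)) /\
  (forall x, x in_A -> forall y, y in_A -> x *R y =R y *R x) /\
  (forall x, x in_A -> x *R one =R x) /\
  (forall x, x in_A -> forall y, y in_A -> forall z, z in_A ->
     x *R (y +R z) =R (x *R y) +R (x *R z)) /\
  ~ (zero =R one).

Definition m_integral_domain : Prop :=
  m_comm_ring /\
  (forall s, s in_A -> forall r, r in_A ->
     r *R s =R zero -> r =R zero \/ s =R zero).

Definition m_maximal_ideal (I : D ty2) : Prop :=
  (mset I /\ (forall x, mmem x I -> x in_A) /\ mmem zero I /\ ~ mmem one I /\
   (forall a, mmem a I -> forall b, mmem b I -> mmem (a +R b) I) /\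
   (forall a, mmem a I -> forall r, r in_A -> mmem (r *R a) I)) /\
  (forall r, r in_A -> ~ mmem r I ->
     exists s, s in_A /\ mmem ((r *R s) +R -R one) I).

End RingStatements.

Definition m_rings_have_maximal_ideals (P : D ty2 -> D ty1 -> D ty1 ->
  D (Arr ty1 (Arr ty1 ty0)) -> D (Arr ty1 (Arr ty1 ty1)) ->
  D (Arr ty1 (Arr ty1 ty1)) -> D (Arr ty1 ty1) -> Prop) : Prop :=
  forall A zero one eqR add mul opp, P A zero one eqR add mul opp ->
  exists I, m_maximal_ideal A zero one add mul opp I.

Definition mpair10 (f : D ty1) (n : N) : D ty1 :=
  mrec M $ (mS M ty0 ty0 (Arr ty0 ty0) $
              (mK M (Arr ty0 (Arr ty0 ty0)) ty0 $ mK M ty0 ty0) $ f) $ n.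

Definition mBOOT : Prop :=
  forall Y : D ty2, exists X : D ty1, mset X /\
    forall n, mmem n X <-> exists f, Y $ mpair10 f n = 0.

Lemma sat_lall s p d v (P : D s -> Prop) :
  (forall x, sat M (vcons s x v)
     (p (fun d' => tVar s (d' s - d s - 1)%nat) (incr s d)) <-> P x) ->
  (sat M v (lall p d) <-> forall x, P x).
Proof. intros H. split; intros X x; apply H, X. Qed.

Lemma sat_limp p q d v P Q : (sat M v (p d) <-> P) -> (sat M v (q d) <-> Q) ->
  (sat M v (limp p q d) <-> (P -> Q)).
Proof. intros H1 H2. simpl. tauto. Qed.

Lemma sat_lneg p d v P : (sat M v (p d) <-> P) -> (sat M v (lneg p d) <-> ~ P).
Proof. intros H. simpl. tauto. Qed.

Lemma sat_land p q d v P Q : (sat M v (p d) <-> P) -> (sat M v (q d) <-> Q) ->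
  (sat M v (land p q d) <-> P /\ Q).
Proof. intros H1 H2. simpl. tauto. Qed.

Lemma sat_lor p q d v P Q : (sat M v (p d) <-> P) -> (sat M v (q d) <-> Q) ->
  (sat M v (lor p q d) <-> P \/ Q).
Proof. intros H1 H2. simpl. tauto. Qed.

Lemma sat_liff p q d v P Q : (sat M v (p d) <-> P) -> (sat M v (q d) <-> Q) ->
  (sat M v (liff p q d) <-> (P <-> Q)).
Proof. intros H1 H2. simpl. tauto. Qed.

Lemma sat_lex s p d v (P : D s -> Prop) :
  (forall x, sat M (vcons s x v)
     (p (fun d' => tVar s (d' s - d s - 1)%nat) (incr s d)) <-> P x) ->
  (sat M v (lex p d) <-> exists x, P x).
Proof.
  intros H. unfold lex.
  rewrite (sat_lneg _ _ _ (forall x, ~ P x)).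
  - split; [apply not_all_not_ex|]. intros [x Hx] X. exact (X x Hx).
  - apply sat_lall. intros x. now apply sat_lneg.
Qed.

(** The classically encoded connectives are exchanged for those of the metalanguage one at a time.
    Atoms agree by computation, since all de Bruijn indices are concrete. *)
Ltac sat_step :=
  lazymatch goal with
  | |- _ <-> (_ /\ _) => apply sat_land
  | |- _ <-> (_ \/ _) => apply sat_lor
  | |- _ <-> (_ <-> _) => apply sat_liff
  | |- _ <-> ~ _ => apply sat_lneg
  | |- _ <-> exists x, _ => apply sat_lex; intros ?
  | |- _ <-> _ = _ => exact (iff_refl _)
  | |- _ <-> mmem _ _ => exact (iff_refl _)
  | |- _ <-> mset _ => unfold mset; apply sat_lall; intros ?
  | |- _ <-> (_ -> _) => first [apply sat_limp | apply sat_lall; intros ?]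
  | |- _ <-> forall x, _ => apply sat_lall; intros ?
  end.

Lemma sat_BOOT v : sat M v (closed BOOT) <-> mBOOT.
Proof. unfold mBOOT, closed, BOOT. repeat sat_step. Qed.

Lemma sat_rings v :
  sat M v (closed every_comm_ring_has_maximal_ideal) <->
  m_rings_have_maximal_ideals m_comm_ring.
Proof.
  unfold closed, every_comm_ring_has_maximal_ideal, m_rings_have_maximal_ideals,
    m_comm_ring, m_maximal_ideal, is_comm_ring, is_maximal_ideal, is_ideal.
  repeat sat_step.
Qed.

Lemma sat_domains v :
  sat M v (closed every_integral_domain_has_maximal_ideal) <->
  m_rings_have_maximal_ideals m_integral_domain.
Proof.
  unfold closed, every_integral_domain_has_maximal_ideal,
    m_rings_have_maximal_ideals, m_integral_domain, m_comm_ring,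
    m_maximal_ideal, is_integral_domain, is_comm_ring, is_maximal_ideal,
    is_ideal.
  repeat sat_step.
Qed.

(** * The ring *)

Fixpoint num (i : nat) : N :=
  match i with
  | O => 0
  | S i => num i + 1
  end.

Lemma num_inj i : forall j, num i = num j -> i = j.
Proof.
  induction i; destruct j; simpl; intros E; auto.
  - symmetry in E. now apply succ_ne0 in E.
  - now apply succ_ne0 in E.
  - f_equal. now apply IHi, add_cancel with 1.
Qed.

(* An element [z] codes five type 1 objects: two for the numerator, two for the
   denominator, and a sequence of witnesses. *)
Definition fld (i : nat) (z : D ty1) (t : N) : N := z $ pair (num i) t.

Definition el (f0 f1 f2 f3 f4 : N -> N) : D ty1 :=
  lam (fun k =>
    ite (fstN k = num 0) (f0 (sndN k))
   (ite (fstN k = num 1) (f1 (sndN k))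
   (ite (fstN k = num 2) (f2 (sndN k))
   (ite (fstN k = num 3) (f3 (sndN k)) (f4 (sndN k)))))).

#[local] Hint Unfold fld el : definable.

Lemma fld_el f0 f1 f2 f3 f4 :
  rep [ty0] (fun e => f0 (snd e)) -> rep [ty0] (fun e => f1 (snd e)) ->
  rep [ty0] (fun e => f2 (snd e)) -> rep [ty0] (fun e => f3 (snd e)) ->
  rep [ty0] (fun e => f4 (snd e)) ->
  forall t, let z := el f0 f1 f2 f3 f4 in
  fld 0 z t = f0 t /\ fld 1 z t = f1 t /\ fld 2 z t = f2 t /\
  fld 3 z t = f3 t /\ fld 4 z t = f4 t.
Proof.
  intros R0 R1 R2 R3 R4 t z.
  assert (E : forall i, fld i z t =
    ite (num i = num 0) (f0 t) (ite (num i = num 1) (f1 t)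
   (ite (num i = num 2) (f2 t) (ite (num i = num 3) (f3 t) (f4 t))))).
  { intros i. unfold fld, z, el. rewrite lam_eq.
    - now rewrite fstN_pair, sndN_pair.
    - autounfold with definable.
      repeat first [rp_step | apply (rep_comp _ _ _ f0); [assumption|]
        | apply (rep_comp _ _ _ f1); [assumption|]
        | apply (rep_comp _ _ _ f2); [assumption|]
        | apply (rep_comp _ _ _ f3); [assumption|]
        | apply (rep_comp _ _ _ f4); [assumption|]]. }
  rewrite !E.
  repeat split;
    repeat first [rewrite ite_true by reflexivity
                 |rewrite ite_false by (intros X; now apply num_inj in X)];
    reflexivity.
Qed.

(** * Fractions carrying witnesses *)

Section Ring.
Variable Y : D ty2.

Definition wit (z : D ty1) (n : N) : D ty1 := lam (fun i => fld 4 z (pair n i)).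
Definition good (z : D ty1) (n : N) : Prop := Y $ mpair10 (wit z n) n = 0.
(** At a position [k = pair n i] the choice depends on [n] alone, so a whole witness is taken from
    [z] if it is valid there, and from [z'] otherwise. The valid indices of the result are the union
    of those of [z] and [z']. *)
Definition merge (z z' : D ty1) (k : N) : N :=
  ite (good z (fstN k)) (fld 4 z k) (fld 4 z' k).

#[local] Hint Unfold mpair10 wit good merge : definable.

Lemma repP_comp2 L r s (P : D r -> D s -> Prop) G H :
  repP [s; r] (fun e => P (snd (fst e)) (snd e)) ->
  rep L G -> rep L H -> repP L (fun e => P (G e) (H e)).
Proof. apply (rep_comp2 L r s ty0 (fun x y => chi (P x y))). Qed.

Lemma wit_eq z n i : wit z n $ i = fld 4 z (pair n i).
Proof. apply (lam_eq ty0 ty0 (fun i => fld 4 z (pair n i))). rp. Qed.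

Lemma good_ext z z' n :
  (forall i, fld 4 z (pair n i) = fld 4 z' (pair n i)) -> good z n <-> good z' n.
Proof.
  intros E. unfold good. replace (wit z' n) with (wit z n); [reflexivity|].
  apply app_ext. intros i. now rewrite !wit_eq.
Qed.

Lemma good_merge u z z' n :
  (forall k, fld 4 u k = merge z z' k) -> good u n <-> good z n \/ good z' n.
Proof.
  intros E. unfold merge in E. destruct (classic (good z n)) as [G|G].
  - rewrite (good_ext u z n); [tauto|]. intros i.
    now rewrite E, fstN_pair, ite_true.
  - rewrite (good_ext u z' n); [tauto|]. intros i.
    now rewrite E, fstN_pair, ite_false.
Qed.

Definition nume (z : D ty1) (t : N) : Zm := mk (fld 0 z t) (fld 1 z t).
Definition deno (z : D ty1) (t : N) : Zm := mk (fld 2 z t) (fld 3 z t).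

(** Points are coded by numbers and [good z] is read off [z], so the condition is arithmetical in
    [z] and [Y]. Membership in the set defined by [Y] would need a quantifier over type 1. *)
Definition indom (z : D ty1) : Prop :=
  congruence_preserving (nume z) /\ congruence_preserving (deno z) /\
  exists t, (forall n, ~ good z n -> coord n t = 0) /\ deno z t <> z0.

Definition reqv (z z' : D ty1) : Prop :=
  forall t, nume z t *z deno z' t = nume z' t *z deno z t.

Definition rzero : D ty1 :=
  el (fun _ => 0) (fun _ => 0) (fun _ => 1) (fun _ => 0) (fun _ => 0).
Definition rone : D ty1 :=
  el (fun _ => 1) (fun _ => 0) (fun _ => 1) (fun _ => 0) (fun _ => 0).
Definition ropp (z : D ty1) : D ty1 :=
  el (fld 1 z) (fld 0 z) (fld 2 z) (fld 3 z) (fld 4 z).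
Definition rinv (z : D ty1) : D ty1 :=
  el (fld 2 z) (fld 3 z) (fld 0 z) (fld 1 z) (fld 4 z).
Definition radd (z z' : D ty1) : D ty1 :=
  el (fun t => fld 0 z t * fld 2 z' t + fld 1 z t * fld 3 z' t +
               (fld 0 z' t * fld 2 z t + fld 1 z' t * fld 3 z t))
     (fun t => fld 0 z t * fld 3 z' t + fld 1 z t * fld 2 z' t +
               (fld 0 z' t * fld 3 z t + fld 1 z' t * fld 2 z t))
     (fun t => fld 2 z t * fld 2 z' t + fld 3 z t * fld 3 z' t)
     (fun t => fld 2 z t * fld 3 z' t + fld 3 z t * fld 2 z' t)
     (merge z z').
Definition rmul (z z' : D ty1) : D ty1 :=
  el (fun t => fld 0 z t * fld 0 z' t + fld 1 z t * fld 1 z' t)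
     (fun t => fld 0 z t * fld 1 z' t + fld 1 z t * fld 0 z' t)
     (fun t => fld 2 z t * fld 2 z' t + fld 3 z t * fld 3 z' t)
     (fun t => fld 2 z t * fld 3 z' t + fld 3 z t * fld 2 z' t)
     (merge z z').

(* Ideals need not be closed under the equality of the ring.  Returning the very
   element [rone] ensures that no ideal contains a unit. *)
Definition nmul (z z' : D ty1) : D ty1 :=
  lam (fun k => ite (reqv (rmul z z') rone) (rone $ k) (rmul z z' $ k)).

(* [x_n] and, for a witness [f] of [n], its inverse. *)
Definition rvar (n : N) : D ty1 :=
  el (fun t => coord n t) (fun _ => 0) (fun _ => 1) (fun _ => 0) (fun _ => 0).
Definition rvar_inv (n : N) (f : D ty1) : D ty1 :=
  el (fun _ => 1) (fun _ => 0) (fun t => coord n t) (fun _ => 0)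
     (fun k => f $ sndN k).

#[local] Hint Unfold rzero rone ropp rinv radd rmul nmul rvar rvar_inv
  : definable.

Lemma repP_cp i j :
  repP [ty1] (fun e => congruence_preserving
                         (fun t => mk (fld i (snd e) t) (fld j (snd e) t))).
Proof.
  (* The integer multiplier is written as a difference of two numbers [x] and [y], which leaves only
     quantifiers over type 0. *)
  eapply repP_ext with (P := fun e => forall m t t',
    (forall n, exists c c', coord n t + m * c = coord n t' + m * c') ->
    exists x y, fld i (snd e) t + (fld j (snd e) t' + (m * y + 0 * x)) =
      fld i (snd e) t' + (m * x + 0 * y) + fld j (snd e) t).
  - rp.
  - intros e. unfold congruence_preserving.
    split; intros H m t t' C; specialize (H m t t' C).
    + destruct H as (x & y & H). exists (mk x y). unfold zof.
      now rewrite zmul_mk, zadd_mk, mk_eq.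
    + destruct H as [z H]. destruct (mk_surj z) as (x & y & ->). exists x, y.
      unfold zof in H. now rewrite zmul_mk, zadd_mk, mk_eq in H.
Qed.

Lemma repP_indom : repP [ty1] (fun e => indom (snd e)).
Proof.
  unfold indom. repeat apply repP_and; try apply repP_cp.
  apply repP_ex, repP_and; [rp|].
  apply repP_ext with (fun e => fld 2 (snd (fst e)) (snd e) <>
                                fld 3 (snd (fst e)) (snd e)).
  - rp.
  - intros e. symmetry. apply mk_ne0.
Qed.

Lemma reqv_fld z z' : (forall t,
    fld 0 z t * fld 2 z' t + fld 1 z t * fld 3 z' t +
    (fld 0 z' t * fld 3 z t + fld 1 z' t * fld 2 z t) =
    fld 0 z' t * fld 2 z t + fld 1 z' t * fld 3 z t +
    (fld 0 z t * fld 3 z' t + fld 1 z t * fld 2 z' t)) <-> reqv z z'.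
Proof.
  unfold reqv, nume, deno.
  split; intros H t; specialize (H t); revert H; now rewrite !zmul_mk, mk_eq.
Qed.

Lemma repP_reqv L F G : rep L F -> rep L G -> repP L (fun e => reqv (F e) (G e)).
Proof.
  apply repP_comp2. eapply repP_ext; [|intros e; apply reqv_fld]. rp.
Qed.

Ltac rp ::=
  autounfold with definable;
  repeat first [rp_step | cbv beta; apply repP_reqv].

Ltac fields :=
  unfold nume, deno;
  match goal with
  | |- context [fld _ (el ?f0 ?f1 ?f2 ?f3 ?f4) ?t] =>
      destruct (fld_el f0 f1 f2 f3 f4
        ltac:(rp) ltac:(rp) ltac:(rp) ltac:(rp) ltac:(rp) t)
        as (E0 & E1 & E2 & E3 & E4); cbv zeta in E0, E1, E2, E3, E4;
      rewrite ?E0, ?E1, ?E2, ?E3, ?E4; clear E0 E1 E2 E3 E4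
  end.

Lemma radd_eq z z' t : nume (radd z z') t =
    nume z t *z deno z' t +z nume z' t *z deno z t /\
  deno (radd z z') t = deno z t *z deno z' t.
Proof. unfold radd. fields. now rewrite !zmul_mk, zadd_mk. Qed.

Lemma rmul_eq z z' t : nume (rmul z z') t = nume z t *z nume z' t /\
  deno (rmul z z') t = deno z t *z deno z' t.
Proof. unfold rmul. fields. now rewrite !zmul_mk. Qed.

Lemma ropp_eq z t :
  nume (ropp z) t = zopp (nume z t) /\ deno (ropp z) t = deno z t.
Proof. unfold ropp. fields. now rewrite zopp_mk. Qed.

Lemma rinv_eq z t : nume (rinv z) t = deno z t /\ deno (rinv z) t = nume z t.
Proof. unfold rinv. now fields. Qed.

Lemma rzero_eq t : nume rzero t = z0 /\ deno rzero t = z1.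
Proof. unfold rzero. now fields. Qed.

Lemma rone_eq t : nume rone t = z1 /\ deno rone t = z1.
Proof. unfold rone. now fields. Qed.

Lemma rvar_eq n t : nume (rvar n) t = zof (coord n t) /\ deno (rvar n) t = z1.
Proof. unfold rvar. now fields. Qed.

Lemma rvar_inv_eq n f t :
  nume (rvar_inv n f) t = z1 /\ deno (rvar_inv n f) t = zof (coord n t).
Proof. unfold rvar_inv. now fields. Qed.

Lemma good_radd z z' n : good (radd z z') n <-> good z n \/ good z' n.
Proof. apply good_merge. intros k. unfold radd. now fields. Qed.

Lemma good_rmul z z' n : good (rmul z z') n <-> good z n \/ good z' n.
Proof. apply good_merge. intros k. unfold rmul. now fields. Qed.

Lemma good_ropp z n : good (ropp z) n <-> good z n.
Proof. apply good_ext. intros i. unfold ropp. now fields. Qed.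

Lemma good_rinv z n : good (rinv z) n <-> good z n.
Proof. apply good_ext. intros i. unfold rinv. now fields. Qed.

(** The stored sequence of witnesses is constantly [f]. *)
Lemma good_rvar_inv n f m : good (rvar_inv n f) m <-> Y $ mpair10 f m = 0.
Proof.
  unfold good. replace (wit (rvar_inv n f) m) with f; [reflexivity|].
  apply app_ext. intros i. rewrite wit_eq. unfold rvar_inv. fields.
  now rewrite sndN_pair.
Qed.

Lemma nmul_cases z z' :
  (reqv (rmul z z') rone /\ nmul z z' = rone) \/ nmul z z' = rmul z z'.
Proof.
  assert (E : forall k, nmul z z' $ k =
    ite (reqv (rmul z z') rone) (rone $ k) (rmul z z' $ k)).
  { intros k. unfold nmul.
    apply (lam_eq ty0 ty0
      (fun k => ite (reqv (rmul z z') rone) (rone $ k) (rmul z z' $ k))). rp. }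
  destruct (classic (reqv (rmul z z') rone)) as [H|H].
  - left. split; auto. apply app_ext. intros k. now rewrite E, ite_true.
  - right. apply app_ext. intros k. now rewrite E, ite_false.
Qed.

Lemma nmul_one z z' : reqv (rmul z z') rone -> nmul z z' = rone.
Proof.
  intros H. unfold nmul. apply app_ext. intros k.
  rewrite (lam_eq ty0 ty0
    (fun k => ite (reqv (rmul z z') rone) (rone $ k) (rmul z z' $ k)));
    [now apply ite_true|rp].
Qed.

Lemma cp_ext u v : (forall t, u t = v t) ->
  congruence_preserving v -> congruence_preserving u.
Proof. intros E H. replace u with v; auto. extensionality t. auto. Qed.

Lemma z1_ne0 : z1 <> z0.
Proof. apply mk_ne0. intros E. symmetry in E. now apply neq01. Qed.

(** Sums and products share this argument: both denominators are nonzero somewhere on points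
    supported in the valid indices of [u], and functions vanishing on such points form a prime
    ideal. *)
Lemma indom_prod z z' u : indom z -> indom z' ->
  congruence_preserving (nume u) ->
  (forall t, deno u t = deno z t *z deno z' t) ->
  (forall n, good u n <-> good z n \/ good z' n) -> indom u.
Proof.
  intros (_ & C & t & St & Nt) (_ & C' & t' & St' & Nt') Cu E G.
  split; [|split]; auto.
  - apply (cp_ext _ _ E). now apply cp_mul.
  - destruct (cp_nonzero_mul (deno z) (deno z') (good u) t t') as (s & Ss & Ns);
      auto.
    + intros n Hn. apply St. contradict Hn. apply G. auto.
    + intros n Hn. apply St'. contradict Hn. apply G. auto.
    + exists s. now rewrite E.
Qed.

Lemma indom_radd z z' : indom z -> indom z' -> indom (radd z z').
Proof.
  intros H H'. apply (indom_prod z z'); auto using good_radd.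
  - apply (cp_ext _ _ (fun t => proj1 (radd_eq z z' t))).
    apply cp_add; apply cp_mul; apply H || apply H'.
  - apply radd_eq.
Qed.

Lemma indom_rmul z z' : indom z -> indom z' -> indom (rmul z z').
Proof.
  intros H H'. apply (indom_prod z z'); auto using good_rmul.
  - apply (cp_ext _ _ (fun t => proj1 (rmul_eq z z' t))).
    apply cp_mul; apply H || apply H'.
  - apply rmul_eq.
Qed.

Lemma indom_ropp z : indom z -> indom (ropp z).
Proof.
  intros (H1 & H2 & t & St & Nt). split; [|split].
  - apply (cp_ext _ _ (fun t => proj1 (ropp_eq z t))). now apply cp_opp.
  - now apply (cp_ext _ _ (fun t => proj2 (ropp_eq z t))).
  - exists t. split; [|now rewrite (proj2 (ropp_eq z t))].
    intros n Hn. apply St. now rewrite <- good_ropp.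
Qed.

Lemma indom_den1 z u : congruence_preserving u ->
  (forall t, nume z t = u t /\ deno z t = z1) -> indom z.
Proof.
  intros Cu E. split; [|split].
  - now apply (cp_ext _ _ (fun t => proj1 (E t))).
  - apply (cp_ext _ _ (fun t => proj2 (E t))), cp_const.
  (* The code 0 is the origin, whose support is empty, so this point is admissible for any
     witnesses. *)
  - exists 0. split; [intros; apply coord_of_0|].
    rewrite (proj2 (E 0)). apply z1_ne0.
Qed.

Lemma indom_rzero : indom rzero.
Proof. exact (indom_den1 _ _ (cp_const _) rzero_eq). Qed.

Lemma indom_rone : indom rone.
Proof. exact (indom_den1 _ _ (cp_const _) rone_eq). Qed.

Lemma indom_rvar n : indom (rvar n).
Proof. exact (indom_den1 _ _ (cp_coord n) (rvar_eq n)). Qed.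

Lemma indom_nmul z z' : indom z -> indom z' -> indom (nmul z z').
Proof.
  intros H H'. destruct (nmul_cases z z') as [[_ ->]| ->].
  - apply indom_rone.
  - now apply indom_rmul.
Qed.

Lemma indom_rvar_inv n f : Y $ mpair10 f n = 0 -> indom (rvar_inv n f).
Proof.
  intros H. split; [|split].
  - apply (cp_ext _ _ (fun t => proj1 (rvar_inv_eq n f t))), cp_const.
  - apply (cp_ext _ _ (fun t => proj2 (rvar_inv_eq n f t))), cp_coord.
  (* The unit point at [n] is admissible because [f] witnesses [n], and the denominator takes the
     value 1 there. *)
  - destruct (coord_unit n) as (t & E & Z). exists t. split.
    + intros m Hm. apply Z. intros ->. now apply Hm, good_rvar_inv.
    + rewrite (proj2 (rvar_inv_eq n f t)), E. apply z1_ne0.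
Qed.

(** A denominator is a nonzero element of the domain of congruence preserving functions; the support
    set is taken to be everything. *)
Lemma deno_cancel z (h : N -> Zm) : indom z -> congruence_preserving h ->
  (forall t, deno z t *z h t = z0) -> forall t, h t = z0.
Proof.
  intros (_ & C & t' & _ & N') Ch E t. apply NNPP. intros X.
  destruct (cp_nonzero_mul (deno z) h (fun _ => True) t' t) as (s & _ & Ns);
    auto; tauto.
Qed.

Lemma reqv_refl z : reqv z z.
Proof. easy. Qed.

Lemma reqv_sym z z' : reqv z z' -> reqv z' z.
Proof. intros H t. symmetry. apply H. Qed.

Lemma zsub_eq0 x y : zsub x y = z0 -> x = y.
Proof.
  intros E. transitivity (zsub x y +z y); [ring|]. rewrite E. ring.
Qed.

Lemma reqv_trans x y z : indom x -> indom y -> indom z ->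
  reqv x y -> reqv y z -> reqv x z.
Proof.
  intros Hx Hy Hz E1 E2 t.
  (* The cross difference of [x] and [z] vanishes after multiplication by the denominator of [y],
     which can be cancelled. *)
  pose (h t := nume x t *z deno z t +z zopp (nume z t *z deno x t)).
  apply zsub_eq0. refine (deno_cancel y h Hy _ _ t).
  - apply cp_add; [|apply cp_opp]; apply cp_mul; (apply Hx || apply Hz).
  - intros s. unfold h. specialize (E1 s). specialize (E2 s).
    ring [E1 E2].
Qed.

Ltac expand :=
  repeat progress rewrite ?(fun z z' t => proj1 (radd_eq z z' t)),
    ?(fun z z' t => proj2 (radd_eq z z' t)),
    ?(fun z z' t => proj1 (rmul_eq z z' t)),
    ?(fun z z' t => proj2 (rmul_eq z z' t)),
    ?(fun z t => proj1 (ropp_eq z t)), ?(fun z t => proj2 (ropp_eq z t)),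
    ?(fun z t => proj1 (rinv_eq z t)), ?(fun z t => proj2 (rinv_eq z t)),
    ?(fun n t => proj1 (rvar_eq n t)), ?(fun n t => proj2 (rvar_eq n t)),
    ?(fun n f t => proj1 (rvar_inv_eq n f t)),
    ?(fun n f t => proj2 (rvar_inv_eq n f t)),
    ?(fun t => proj1 (rzero_eq t)), ?(fun t => proj2 (rzero_eq t)),
    ?(fun t => proj1 (rone_eq t)), ?(fun t => proj2 (rone_eq t)).

Lemma radd_reqv x x' y y' : reqv x x' -> reqv y y' ->
  reqv (radd x y) (radd x' y').
Proof.
  intros H1 H2 t. specialize (H1 t). specialize (H2 t). expand.
  ring [H1 H2].
Qed.

Lemma rmul_reqv x x' y y' : reqv x x' -> reqv y y' ->
  reqv (rmul x y) (rmul x' y').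
Proof.
  intros H1 H2 t. specialize (H1 t). specialize (H2 t). expand.
  ring [H1 H2].
Qed.

Lemma nmul_reqv z z' : reqv (nmul z z') (rmul z z').
Proof.
  destruct (nmul_cases z z') as [[H ->]| ->].
  - now apply reqv_sym.
  - apply reqv_refl.
Qed.

Lemma nmul_cong x x' y y' : indom x -> indom x' -> indom y -> indom y' ->
  reqv x x' -> reqv y y' -> reqv (nmul x y) (rmul x' y').
Proof.
  intros. apply reqv_trans with (rmul x y);
    auto using indom_nmul, indom_rmul, nmul_reqv, rmul_reqv.
Qed.

(** * The ring inside the model *)

Definition DOM : D ty2 := lam (fun z => chi (indom z)).
Definition EQ : D (Arr ty1 (Arr ty1 ty0)) :=
  lam (fun z => lam (fun z' => chi (reqv z z'))).
Definition ADD : D (Arr ty1 (Arr ty1 ty1)) := lam (fun z => lam (radd z)).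
Definition MUL : D (Arr ty1 (Arr ty1 ty1)) := lam (fun z => lam (nmul z)).
Definition OPP : D (Arr ty1 ty1) := lam ropp.

Lemma DOM_eq z : mmem z DOM <-> indom z.
Proof.
  unfold mmem, DOM. rewrite (lam_eq ty1 ty0 (fun z => chi (indom z))).
  - apply chi1.
  - exact repP_indom.
Qed.

Lemma EQ_chi z z' : EQ $ z $ z' = chi (reqv z z').
Proof.
  unfold EQ. rewrite (lam_eq ty1 _ (fun z => lam (fun z' => chi (reqv z z')))).
  - apply (lam_eq ty1 ty0 (fun z' => chi (reqv z z'))). rp.
  - rp.
Qed.

Lemma EQ_eq z z' : EQ $ z $ z' = 1 <-> reqv z z'.
Proof. rewrite EQ_chi. apply chi1. Qed.

Lemma ADD_eq z z' : ADD $ z $ z' = radd z z'.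
Proof.
  unfold ADD. rewrite (lam_eq ty1 _ (fun z => lam (radd z))).
  - apply (lam_eq ty1 ty1 (radd z)). rp.
  - rp.
Qed.

Lemma MUL_eq z z' : MUL $ z $ z' = nmul z z'.
Proof.
  unfold MUL. rewrite (lam_eq ty1 _ (fun z => lam (nmul z))).
  - apply (lam_eq ty1 ty1 (nmul z)). rp.
  - rp.
Qed.

Lemma OPP_eq z : OPP $ z = ropp z.
Proof. apply (lam_eq ty1 ty1 ropp). rp. Qed.

Lemma mset_chi s (P : D s -> Prop) X :
  (forall x, X $ x = chi (P x)) -> mset X.
Proof.
  intros E x. rewrite E. destruct (classic (P x)).
  - right. now apply chi_true.
  - left. now apply chi_false.
Qed.

(** Laws involving [nmul] are transported along [nmul_reqv] to [rmul], where they are identities of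
    fractions holding pointwise. *)
Lemma ring_comm_ring : m_comm_ring DOM rzero rone EQ ADD MUL OPP.
Proof.
  unfold m_comm_ring.
  repeat match goal with |- _ /\ _ => split end;
    repeat setoid_rewrite DOM_eq; repeat setoid_rewrite EQ_eq;
    repeat setoid_rewrite ADD_eq; repeat setoid_rewrite MUL_eq;
    repeat setoid_rewrite OPP_eq.
  - apply (mset_chi _ indom). intros z. apply lam_eq. exact repP_indom.
  - intros z. apply (mset_chi _ (reqv z)). apply EQ_chi.
  - apply indom_rzero.
  - apply indom_rone.
  - auto using indom_radd.
  - auto using indom_ropp.
  - auto using indom_nmul.
  - auto using reqv_refl.
  - auto using reqv_sym.
  - intros x Hx y Hy z Hz. now apply reqv_trans.
  - auto using radd_reqv.
  - intros x _ x' _ H t. expand.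
    transitivity (zopp (nume x t *z deno x' t)); [ring|]. rewrite (H t). ring.
  - intros x Hx x' Hx' y Hy y' Hy' E1 E2.
    apply reqv_trans with (rmul x' y'); auto using indom_nmul, indom_rmul.
    + now apply nmul_cong.
    + apply reqv_sym, nmul_reqv.
  - intros x _ y _ z _ t. expand. ring.
  - intros x _ y _ t. expand. ring.
  - intros x _ t. expand. ring.
  - intros x _ t. expand. ring.
  - intros x Hx y Hy z Hz.
    apply reqv_trans with (rmul (rmul x y) z);
      auto using indom_nmul, indom_rmul.
    + apply nmul_cong; auto using indom_nmul, indom_rmul, nmul_reqv, reqv_refl.
    + apply reqv_sym. apply reqv_trans with (rmul x (rmul y z));
        auto using indom_nmul, indom_rmul.
      * apply nmul_cong; auto using indom_nmul, indom_rmul, nmul_reqv, reqv_refl.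
      * intros t. expand. ring.
  - intros x Hx y Hy.
    apply reqv_trans with (rmul x y); auto using indom_nmul, indom_rmul, nmul_reqv.
    apply reqv_sym. apply reqv_trans with (rmul y x);
      auto using indom_nmul, indom_rmul, nmul_reqv.
    intros t. expand. ring.
  - intros x Hx. apply reqv_trans with (rmul x rone);
      auto using indom_nmul, indom_rmul, indom_rone, nmul_reqv.
    intros t. expand. ring.
  - intros x Hx y Hy z Hz. apply reqv_trans with (rmul x (radd y z));
      auto using indom_nmul, indom_rmul, indom_radd, nmul_reqv.
    apply reqv_sym. apply reqv_trans with (radd (rmul x y) (rmul x z));
      auto using indom_nmul, indom_rmul, indom_radd, nmul_reqv, radd_reqv.
    intros t. expand. ring.
  - intros H. specialize (H 0). revert H. expand. intros H. apply z1_ne0.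
    transitivity (z1 *z z1); [ring|]. rewrite <- H. ring.
Qed.

(** Two nonzero fractions have numerators that are nonzero at some points [t] and [t']; a common
    point where the product is nonzero then exists. *)
Lemma ring_integral_domain : m_integral_domain DOM rzero rone EQ ADD MUL OPP.
Proof.
  split; [apply ring_comm_ring|].
  setoid_rewrite DOM_eq. setoid_rewrite EQ_eq. setoid_rewrite MUL_eq.
  intros s Hs r Hr E. apply NNPP. intros X. apply not_or_and in X as [Xr Xs].
  assert (NZ : forall z, ~ reqv z rzero -> exists t, nume z t <> z0).
  { intros z Hz. apply not_all_not_ex. intros A. apply Hz. intros t. expand.
    replace (nume z t) with z0; [ring|]. symmetry. apply NNPP, A. }
  destruct (NZ r Xr) as [t Ht], (NZ s Xs) as [t' Ht'].
  destruct (cp_nonzero_mul (nume r) (nume s) (fun _ => True) t t')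
    as (u & _ & Hu); auto; try tauto; try apply Hr; try apply Hs.
  apply Hu. assert (E' : reqv (rmul r s) rzero).
  { apply reqv_trans with (nmul r s);
      auto using indom_nmul, indom_rmul, indom_rzero, nmul_reqv, reqv_sym. }
  specialize (E' u). revert E'. expand. intros E'.
  transitivity (nume r u *z nume s u *z z1); [ring|]. rewrite E'. ring.
Qed.

(** * Units and maximal ideals *)

Lemma indom_rinv z t : indom z -> (forall n, ~ good z n -> coord n t = 0) ->
  nume z t <> z0 -> indom (rinv z).
Proof.
  intros (H1 & H2 & _) St Nt. split; [|split].
  - now apply (cp_ext _ _ (fun t => proj1 (rinv_eq z t))).
  - now apply (cp_ext _ _ (fun t => proj2 (rinv_eq z t))).
  - exists t. split; [|now expand]. intros n Hn. apply St.
    now rewrite <- good_rinv.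
Qed.

(** A witness of [n] makes [rvar n] a unit, which no ideal contains. Without a witness, every
    element [rvar n] times [s] minus one is a unit, so maximality forces [rvar n] into [I]. *)
Lemma maximal_ideal_var I n :
  m_maximal_ideal DOM rzero rone ADD MUL OPP I ->
  ~ mmem (rvar n) I <-> exists f, Y $ mpair10 f n = 0.
Proof.
  unfold m_maximal_ideal. setoid_rewrite DOM_eq. setoid_rewrite ADD_eq.
  setoid_rewrite MUL_eq. setoid_rewrite OPP_eq.
  intros ((_ & ID & _ & I1 & _ & IM) & MAX).
  (* A product equal to one in the ring is returned by [nmul] as the very element [rone], which [I]
     excludes. *)
  assert (U : forall u v, mmem u I -> indom v -> ~ reqv (rmul v u) rone).
  { intros u v Hu Hv E. apply I1. rewrite <- (nmul_one v u E). now apply IM. }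
  split.
  - intros Hn. destruct (MAX _ (indom_rvar n) Hn) as (s & Hs & Hu).
    apply NNPP. intros X.
    (* No fraction can carry a valid witness for [n], so the point [t] at which the denominator of
       [s] is nonzero has [n]-th coordinate 0, and [rvar n] vanishes there. *)
    assert (Xn : forall z, ~ good z n) by (intros z G; apply X; now exists (wit z n)).
    destruct Hs as (Cp & Cq & t & St & Nt).
    destruct (nmul_cases (rvar n) s) as [[E _]|E].
    + apply Nt. specialize (E t). revert E. expand. rewrite (St n) by auto.
      unfold zof. intros E. transitivity (z1 *z (z1 *z deno s t)); [ring|].
      rewrite <- E. ring.
    (* At [t] the numerator of [u] is minus the denominator of [s], hence nonzero; thus the inverse
       fraction is in the ring, and [u] is a unit lying in [I]. *)
    + rewrite E in Hu. set (u := radd _ _) in Hu.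
      apply (U u (rinv u) Hu); [|intros r; expand; ring].
      apply (indom_rinv u t); [now apply ID|..].
      * intros m Hm. apply St. contradict Hm. unfold u.
        rewrite good_radd, good_rmul. auto.
      * intros Eu. apply Nt. revert Eu. unfold u. expand.
        rewrite (St n) by auto. unfold zof. intros Eu.
        transitivity (zopp z0); [rewrite <- Eu|]; ring.
  - intros [f Hf] Hn. apply (U _ (rvar_inv n f) Hn).
    + now apply indom_rvar_inv.
    + intros t. expand. ring.
Qed.

End Ring.

Lemma mBOOT_of_maximal_ideals :
  m_rings_have_maximal_ideals m_integral_domain -> mBOOT.
Proof.
  intros H Y. destruct (H _ _ _ _ _ _ _ (ring_integral_domain Y)) as [I HI].
  (* The ideal is given by a type 2 functional and [rvar n] depends definably on [n], so the
     complement of the ideal, read along the variables, is a type 1 object. *)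
  set (F n := chi (I $ rvar n <> 1)).
  assert (E : forall n, lam F $ n = F n).
  { intros n. apply (lam_eq ty0 ty0 F). unfold F, rvar, el. rp. }
  exists (lam F). split.
  - exact (mset_chi _ _ _ E).
  - intros n. unfold mmem. rewrite E, <- (maximal_ideal_var Y I n HI).
    apply chi1.
Qed.

End Model.

Lemma provable_implies (p q : form) :
  (forall M, models M ACA0w -> forall v,
     sat M v (closed p) -> sat M v (closed q)) ->
  provable ACA0w (closed (limp p q)).
Proof. intros H. apply completeness. exact H. Qed.

Theorem theorem3p41 :
  provable ACA0w (closed (limp every_comm_ring_has_maximal_ideal BOOT)) /\
  provable ACA0w (closed (limp every_integral_domain_has_maximal_ideal BOOT)).
Proof.
  split; apply provable_implies; intros M HM v H; apply sat_BOOT;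
    apply mBOOT_of_maximal_ideals; auto.
  - apply sat_rings in H. intros A zero one eqR add mul opp [R _].
    now apply H in R.
  - now apply sat_domains in H.
Qed.
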